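(* Let $n\geqslant 2.16\times 10^{17}$ and let $G$ be a planar graph on $n$ vertices that does not contain $C_3\cdot C_3$ (the graph obtained from $K_4$ by deleting one edge) as a subgraph. Then $\rho(G)\leqslant \rho(K_{2,n-2})$, with equality if and only if $G\cong K_{2,n-2}$.
   Context: All graphs are finite and simple. $\rho(G)$ denotes the spectral radius of the adjacency matrix of $G$. $C_a\cdot C_b$ denotes the graph obtained from cycles $C_a$ and $C_b$ by identifying an edge of $C_a$ with an edge of $C_b$; thus $C_3\cdot C_3$ is two triangles sharing an edge, i.e. $K_4$ minus an edge. $K_{2,n-2}$ is the complete bipartite graph with parts of sizes $2$ and $n-2$. *)

(* Defs.v *)
From Stdlib Require Import Reals.
From mathcomp Require Import all_boot all_order all_algebra all_fingroup all_field.
Set Implicit Arguments. Unset Strict Implicit. Unset Printing Implicit Defensive.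
Import GRing.Theory Num.Theory.

Definition simple_graph (n : nat) (e : rel 'I_n) : Prop :=
  (forall i, ~~ e i i) /\ (forall i j, e i j = e j i).

(* ---------- Planarity (topological definition) ----------
   A drawing: vertices are sent injectively to points of R^2, each edge
   {u,v} (u < v) to a continuous arc gamma u v : [0,1] -> R^2 (coordinate
   functions continuous; given as functions on all of R), injective on [0,1],
   from the point of u to the point of v; interior points of an arc meet no
   vertex point and no point of another arc. *)
Definition unit_int (t : R) : Prop := Rle R0 t /\ Rle t R1.

Definition planar (n : nat) (e : rel 'I_n) : Prop :=
  exists (px py : 'I_n -> R) (gx gy : 'I_n -> 'I_n -> R -> R),
    (forall u v, px u = px v -> py u = py v -> u = v) /\
    (forall u v : 'I_n, ltn u v -> e u v ->
       continuity (gx u v) /\ continuity (gy u v) /\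
       gx u v R0 = px u /\ gy u v R0 = py u /\
       gx u v R1 = px v /\ gy u v R1 = py v /\
       (forall s t, unit_int s -> unit_int t ->
          gx u v s = gx u v t -> gy u v s = gy u v t -> s = t) /\
       (forall (s : R) (w : 'I_n), unit_int s -> gx u v s = px w -> gy u v s = py w ->
          s = R0 \/ s = R1)) /\
    (forall (u v u' v' : 'I_n) (s t : R), ltn u v -> e u v -> ltn u' v' -> e u' v' ->
       (u, v) <> (u', v') -> unit_int s -> unit_int t ->
       gx u v s = gx u' v' t -> gy u v s = gy u' v' t ->
       (s = R0 \/ s = R1) /\ (t = R0 \/ t = R1)).

Local Open Scope ring_scope.

Definition adjmx (n : nat) (e : rel 'I_n) : 'M[algC]_n :=
  \matrix_(i, j) (e i j)%:R.

Definition spectral_radius_is (n : nat) (A : 'M[algC]_n) (r : algC) : Prop :=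
  (exists2 a, eigenvalue A a & `|a| = r) /\
  (forall a, eigenvalue A a -> `|a| <= r).

Definition has_C3C3 (n : nat) (e : rel 'I_n) : Prop :=
  exists a b c d : 'I_n,
    [/\ uniq [:: a; b; c; d],
        e a b, e a c, e a d & e b c /\ e b d].

Definition K2n (n : nat) : rel 'I_n :=
  fun i j => ((i < 2)%N != (j < 2)%N).

Definition graph_iso (n : nat) (e f : rel 'I_n) : Prop :=
  exists s : {perm 'I_n}, forall i j, f (s i) (s j) = e i j.

(* Main.v *)
Require Import Defs.
From Stdlib Require Import Reals Lra Ring ClassicalEpsilon.
From mathcomp Require Import all_boot all_order all_algebra all_fingroup all_field.
Set Implicit Arguments. Unset Strict Implicit. Unset Printing Implicit Defensive.
Import GRing.Theory Num.Theory.
Delimit Scope R_scope with Re.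

(** Planarity enters only through two facts: three vertices have at most two
    common neighbours, and every vertex set V spans at most 6|V| edges.  Both
    come from the van Kampen form of the non-planarity of K_{3,3}: there is no
    map of K_{3,3} to the plane under which disjoint edges have disjoint
    images, because the identities mod 2 saying that the direction from a point
    of one edge to a point of a disjoint edge has winding number 0 around the
    product of the two edges add up to 1 = 0.  This form rules out K_{3,3} as a
    minor, and Mader's contraction argument then bounds the number of edges.

    Let r be the spectral radius and y the vector of absolute values of an
    eigenvector, scaled to have maximum 1 = y_p, so that r y <= A y.  If
    r^2 >= 2(n - 2), expanding r^2 y_v <= sum_{u ~ v} sum_{w ~ u} y_w shows that
    boundedly many y_v exceed a small constant, that some q <> p has y_q close
    to 1, that p and q are adjacent to almost all vertices, and that y <= 1/17
    off {p, q}.  If b is the number of remaining vertices that miss p or q, the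
    vertices off {p, q} span at most 8b edges, and the same expansion at p reads
    2(n - 2) <= 2(n - 2) - b + 16b/17.  Hence b = 0 and G = K_{2,n-2}. *)

(** * Path-connected sets in the plane *)

(** Paths are defined on the whole line and stay in [S] for every parameter, which spares all
    restrictions to [0,1]; precomposing with [clamp] brings a path on [0,1] into this form. *)
Definition path_connected (S : R * R -> Prop) : Prop :=
  forall p q, S p -> S q -> exists gx gy : R -> R,
    [/\ continuity gx, continuity gy, (gx R0, gy R0) = p,
        (gx R1, gy R1) = q & forall t, S (gx t, gy t)].

Definition clamp (t : R) : R := Rmax 0%Re (Rmin 1%Re t).

Lemma clamp_ge0_le1 (t : R) : (0 <= clamp t <= 1)%Re.
Proof.
rewrite /clamp; split; first exact: Rmax_l.
by apply: Rmax_lub; [lra | exact: Rmin_l].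
Qed.

Lemma clamp_id (t : R) : (0 <= t <= 1)%Re -> clamp t = t.
Proof. by move=> [h0 h1]; rewrite /clamp Rmin_right // Rmax_right. Qed.

Lemma clamp_le0 (t : R) : (t <= 0)%Re -> clamp t = R0.
Proof. by move=> h; rewrite /clamp Rmin_right ?Rmax_left //; lra. Qed.

Lemma clamp_ge1 (t : R) : (1 <= t)%Re -> clamp t = R1.
Proof. by move=> h; rewrite /clamp Rmin_left ?Rmax_right //; lra. Qed.

Lemma clamp_lipschitz (s t : R) :
  (Rabs (clamp s - clamp t) <= Rabs (s - t))%Re.
Proof.
rewrite /clamp /Rmin; case: (Rle_dec 1 s) => ?; case: (Rle_dec 1 t) => ?;
rewrite /Rmax; repeat (case: Rle_dec => ?); split_Rabs; lra.
Qed.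

Lemma clamp_continuity : continuity clamp.
Proof.
move=> x eps heps; exists eps; split=> // y [_ hy].
exact: Rle_lt_trans (clamp_lipschitz _ _) hy.
Qed.

Lemma continuity_affine (a b : R) : continuity (fun t => a * t + b)%Re.
Proof. by apply: derivable_continuous; reg. Qed.

Lemma continuity_clamp_affine (f : R -> R) (a b : R) :
  continuity f -> continuity (fun t => f (clamp (a * t + b)))%Re.
Proof.
move=> cf; apply: (continuity_comp (fun t => clamp (a * t + b))%Re f) => //.
exact: (continuity_comp _ _ (continuity_affine a b) clamp_continuity).
Qed.

(* With reparametrisations clamped to [0,1], a concatenation is the continuous
   sum f (2t) + g (2t - 1) - f 1, with no gluing of pieces. *)
Lemma path_connected_setU (A B : R * R -> Prop) (m : R * R) :
  path_connected A -> path_connected B -> A m -> B m ->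
  path_connected (fun p => A p \/ B p).
Proof.
have rev (S : R * R -> Prop) p q :
    (exists gx gy : R -> R,
    [/\ continuity gx, continuity gy, (gx R0, gy R0) = p,
        (gx R1, gy R1) = q & forall t, S (gx t, gy t)]) ->
    (exists gx gy : R -> R,
    [/\ continuity gx, continuity gy, (gx R0, gy R0) = q,
        (gx R1, gy R1) = p & forall t, S (gx t, gy t)]).
  case=> gx [gy [cx cy h0 h1 hS]].
  exists (fun t => gx (clamp (-1 * t + 1)))%Re, (fun t => gy (clamp (-1 * t + 1)))%Re.
  split; try exact: continuity_clamp_affine; last by move=> t.
  - by rewrite clamp_ge1 //; lra.
  - by rewrite clamp_le0 //; lra.
have cat p q : A p -> B q -> path_connected A -> path_connected B -> A m -> B m ->
    exists gx gy : R -> R,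
    [/\ continuity gx, continuity gy, (gx R0, gy R0) = p,
        (gx R1, gy R1) = q & forall t, A (gx t, gy t) \/ B (gx t, gy t)].
  move=> Ap Bq cA cB Am Bm.
  have [fx [fy [cfx cfy f0 f1 fA]]] := cA _ _ Ap Am.
  have [gx [gy [cgx cgy g0 g1 gB]]] := cB _ _ Bm Bq.
  have [fx1 fy1] : fx R1 = gx R0 /\ fy R1 = gy R0.
    by move: f1 g0 => <- [-> ->].
  have cc f g : continuity f -> continuity g -> continuity
      (fun t => f (clamp (2 * t + 0)) + (g (clamp (2 * t + -1)) - f R1))%Re.
    move=> cf cg; apply: continuity_plus; first exact: continuity_clamp_affine.
    apply: continuity_minus; first exact: continuity_clamp_affine.
    by apply: continuity_const => ? ?.
  exists (fun t => fx (clamp (2 * t + 0)) + (gx (clamp (2 * t + -1)) - fx R1))%Re.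
  exists (fun t => fy (clamp (2 * t + 0)) + (gy (clamp (2 * t + -1)) - fy R1))%Re.
  split; [exact: cc | exact: cc | | |].
  - rewrite -f0 !(clamp_le0 (t := _ + _)%Re); try lra.
    by rewrite fx1 fy1; congr pair; lra.
  - rewrite -g1 !(clamp_ge1 (t := _ + _)%Re); try lra.
    by congr pair; lra.
  - move=> t; case: (Rle_dec t (1/2)) => ht.
    + left; rewrite (clamp_le0 (t := 2 * t + -1)%Re); last lra.
      by rewrite fx1 fy1 !Rminus_diag !Rplus_0_r; apply: fA.
    + right; rewrite (clamp_ge1 (t := 2 * t + 0)%Re); last lra.
      set c := clamp _.
      rewrite (_ : (_ + _)%Re = gx c); last by ring.
      rewrite (_ : (_ + _)%Re = gy c); last by ring.
      exact: gB.
move=> cA cB Am Bm p q [Ap|Bp] [Aq|Bq].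
- have [gx [gy [? ? ? ? h]]] := cA _ _ Ap Aq.
  by exists gx, gy; split=> // t; left.
- exact: cat.
- by apply: (rev (fun p => A p \/ B p)); apply: cat.
- have [gx [gy [? ? ? ? h]]] := cB _ _ Bp Bq.
  by exists gx, gy; split=> // t; right.
Qed.

(** * Crossing parity and the non-planarity of K_{3,3} *)

(* The half-open lower half plane: for [p <> 0] exactly one of [p], [-p] is in it. *)
Definition lower (p : R * R) : bool :=
  if Rlt_dec p.2 0 then true else
  if Rlt_dec 0 p.2 then false else
  if Rlt_dec p.1 0 then true else false.

Definition right_half (p : R * R) : bool := if Rlt_dec 0 p.1 then true else false.

(* For [p] and [q] close to each other and away from 0, this says that the segment
   [p, q] crosses the positive horizontal half-axis. *)
Definition crosses (p q : R * R) : bool :=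
  (lower p (+) lower q) && right_half p.

Definition sub2 (p q : R * R) : R * R := (p.1 - q.1, p.2 - q.2)%Re.

Lemma lower_sub2C (p q : R * R) : p <> q -> lower (sub2 p q) = ~~ lower (sub2 q p).
Proof.
case: p q => [a b] [c d] ne; rewrite /lower /sub2 /=.
repeat (case: Rlt_dec => ?) => //=; try lra.
by case: ne; congr pair; lra.
Qed.

Definition far (delta : R) (p : R * R) : Prop :=
  (delta <= Rabs p.1 \/ delta <= Rabs p.2)%Re.

Definition near (delta : R) (p q : R * R) : Prop :=
  (Rabs (p.1 - q.1) < delta / 2 /\ Rabs (p.2 - q.2) < delta / 2)%Re.

Lemma near_sym (delta : R) (p q : R * R) : near delta p q -> near delta q p.
Proof. by rewrite /near !(Rabs_minus_sym q.1) !(Rabs_minus_sym q.2). Qed.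

Lemma near_lower_neq (delta : R) (p q : R * R) :
  near delta p q -> lower p != lower q -> (Rabs q.2 < delta / 2)%Re.
Proof.
move: p q => [a b] [c d]; rewrite /near /lower /= => [[_ /Rabs_def2 [h1 h2]]] ne.
apply: Rabs_def1.
  by move: ne; case: (Rlt_dec d 0) => ?; [lra | case: (Rlt_dec b 0) => ?; [lra|]];
     case: (Rlt_dec 0 d) => ?; case: (Rlt_dec 0 b) => ? // _; lra.
by move: ne; case: (Rlt_dec d 0) => ?; case: (Rlt_dec b 0) => ? //;
  case: (Rlt_dec 0 b) => ? // _; lra.
Qed.

Lemma far_fst (delta : R) (p : R * R) : (0 < delta)%Re ->
  far delta p -> (Rabs p.2 < delta)%Re -> (delta <= Rabs p.1)%Re.
Proof. by move=> d0 [//|h] h'; lra. Qed.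

(** The half in [near] pays off here: both second coordinates stay below [delta], so both first
    coordinates have absolute value at least [delta]; being less than [delta / 2] apart, they have
    the same sign. *)
Lemma near_right_half (delta : R) (p q : R * R) : (0 < delta)%Re ->
  far delta p -> far delta q -> near delta p q -> (Rabs p.2 < delta / 2)%Re ->
  right_half p = right_half q.
Proof.
move=> d0 fp fq [n1 n2] hp.
have hq : (Rabs q.2 < delta)%Re.
  have := Rabs_triang_inv q.2 p.2; rewrite (Rabs_minus_sym q.2) => h; lra.
have {}hp : (Rabs p.2 < delta)%Re by lra.
have {}fp := far_fst d0 fp hp; have {}fq := far_fst d0 fq hq.
rewrite /right_half; case: Rlt_dec => ?; case: Rlt_dec => ? //; exfalso;
move: fp fq n1; split_Rabs; lra.
Qed.

(** Negation swaps the two horizontal half-axes, and a short step far from 0 crosses their union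
    exactly when [lower] changes. *)
Lemma crosses_sub2C (delta : R) (p q z : R * R) : (0 < delta)%Re ->
  far delta (sub2 p z) -> far delta (sub2 q z) -> near delta (sub2 p z) (sub2 q z) ->
  crosses (sub2 z p) (sub2 z q) =
  crosses (sub2 p z) (sub2 q z) (+) (lower (sub2 p z) (+) lower (sub2 q z)).
Proof.
move=> d0 fp fq n.
have ne w : far delta (sub2 w z) -> z <> w.
  by move=> + e; rewrite e /far /sub2 /= !Rminus_diag Rabs_R0; lra.
have [e|/negP/negP ne'] := eqVneq (lower (sub2 p z)) (lower (sub2 q z)).
  by rewrite /crosses (lower_sub2C (ne _ fp)) (lower_sub2C (ne _ fq)) e !addbb.
have := near_lower_neq (near_sym n); rewrite eq_sym => /(_ ne') hp.
have {}hp : (Rabs (sub2 p z).2 < delta)%Re by lra.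
have {}fp' := far_fst d0 fp hp.
rewrite /crosses /right_half (lower_sub2C (ne _ fp)) (lower_sub2C (ne _ fq)) /=.
move: ne'; case: (lower (sub2 p z)); case: (lower (sub2 q z)) => //= _;
move: fp'; rewrite /sub2 /=; repeat (case: Rlt_dec => ? //=); split_Rabs; lra.
Qed.

(** A small quadrilateral away from 0 has winding number 0 mod 2. If [lower] changes along one side,
    all four vertices lie on the same side of the vertical axis, and the changes of [lower] around a
    closed polygon cancel. *)
Lemma crosses_cell (delta : R) (p q r s : R * R) : (0 < delta)%Re ->
  far delta p -> far delta q -> far delta r -> far delta s ->
  near delta p q -> near delta q r -> near delta s r -> near delta p s ->
  crosses p q (+) crosses s r = crosses p s (+) crosses q r.
Proof.
move=> d0 fp fq fr fs pq qr sr ps.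
have side x y z : far delta x -> far delta y -> far delta z ->
   near delta x y -> near delta y z -> lower x != lower y ->
   right_half x = right_half y /\ right_half z = right_half y.
  move=> fx fy fz xy yz ne; have hy := near_lower_neq xy ne.
  by rewrite -(near_right_half d0 fy fx (near_sym xy) hy) -(near_right_half d0 fy fz yz hy).
have H1 := side _ _ _ fp fq fr pq qr.
have H2 := side _ _ _ fq fp fs (near_sym pq) ps.
have H3 := side _ _ _ fq fr fs qr (near_sym sr).
have H4 := side _ _ _ fr fq fp (near_sym qr) (near_sym pq).
have H5 := side _ _ _ fs fr fq sr (near_sym qr).
have H6 := side _ _ _ fr fs fp (near_sym sr) (near_sym ps).
have H7 := side _ _ _ fp fs fr ps sr.
have H8 := side _ _ _ fs fp fq (near_sym ps) pq.
rewrite /crosses; clear -H1 H2 H3 H4 H5 H6 H7 H8.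
move: (right_half p) (right_half q) (right_half r) (right_half s) H1 H2 H3 H4 H5 H6 H7 H8.
move=> rp rq rr rs; case: (lower p); case: (lower q); case: (lower r); case: (lower s) => //= *;
repeat match goal with
  | H : is_true true -> _ |- _ => case: (H isT) => {H}
  | H : is_true false -> _ |- _ => clear H
  end;
by case: rp; case: rq; case: rr; case: rs.
Qed.

(** Discrete Stokes mod 2: when the cell identities are added up, each interior edge of the grid
    lies in two cells and cancels. *)
Lemma grid_parity (h v : nat -> nat -> bool) (N : nat) :
  (forall k l, k < N -> l < N -> h k l (+) h k l.+1 = v k l (+) v k.+1 l) ->
  \big[addb/false]_(k < N) h k 0 (+) \big[addb/false]_(k < N) h k N =
  \big[addb/false]_(l < N) v 0 l (+) \big[addb/false]_(l < N) v N l.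
Proof.
move=> cell.
have strip l K : l < N -> K <= N ->
    \big[addb/false]_(k < K) h k l (+) \big[addb/false]_(k < K) h k l.+1 = v 0 l (+) v K l.
  move=> ln; elim: K => [_|K IH KN]; first by rewrite !big_ord0 !addbb.
  have := IH (ltnW KN); have := cell K l KN ln; rewrite !big_ord_recr /=.
  by do ![case: (\big[_/_]_(_ < _) _)]; case: (h _ _); case: (h _ _); case: (v _ _);
     case: (v _ _); case: (v _ _).
suff rect L : L <= N -> \big[addb/false]_(k < N) h k 0 (+) \big[addb/false]_(k < N) h k L =
  \big[addb/false]_(l < L) v 0 l (+) \big[addb/false]_(l < L) v N l by exact: rect.
elim: L => [_|L IH LN]; first by rewrite !big_ord0 !addbb.
have := IH (ltnW LN); have := strip L N LN (leqnn _); rewrite !(big_ord_recr L) /=.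
by do ![case: (\big[_/_]_(_ < _) _)]; case: (v _ _); case: (v _ _).
Qed.

(** Compactness of the square comes from two one-variable minimisations, first over [t] for each
    [s], then of the resulting [m], which is continuous by [mlip]. The sum of the two coordinate
    distances is at least the minimum, so one of them is at least half of it. *)
Lemma disjoint_arcs_gap (fx fy gx gy : R -> R) :
  continuity fx -> continuity fy -> continuity gx -> continuity gy ->
  (forall s t, (fx s, fy s) <> (gx t, gy t)) ->
  exists2 delta, (0 < delta)%Re & forall s t, (0 <= s <= 1)%Re -> (0 <= t <= 1)%Re ->
    far delta (sub2 (fx s, fy s) (gx t, gy t)).
Proof.
move=> cfx cfy cgx cgy dis.
pose phi s t := (Rabs (fx s - gx t) + Rabs (fy s - gy t))%Re.
have cphi s : continuity (phi s).
  apply: continuity_plus; apply: (continuity_comp (fun t => _ - _)%Re Rabs) => //;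
  try exact: Rcontinuity_abs.
    by apply: continuity_minus => //; apply: continuity_const => ? ?.
  by apply: continuity_minus => //; apply: continuity_const => ? ?.
have le01 : (0 <= 1)%Re by lra.
pose mins s := constructive_indefinite_description _
  (continuity_ab_min (phi s) 0 1 le01 (fun c _ => cphi s c)).
pose tau s := proj1_sig (mins s).
have tauP s t : (0 <= t <= 1)%Re -> (phi s (tau s) <= phi s t)%Re.
  by move=> ht; have [h _] := proj2_sig (mins s); apply: h.
have tau01 s : (0 <= tau s <= 1)%Re by have [_] := proj2_sig (mins s).
pose m s := phi s (tau s).
have mlip s s' : (m s <= m s' + (Rabs (fx s - fx s') + Rabs (fy s - fy s')))%Re.
  apply: Rle_trans (tauP s (tau s') (tau01 s')) _; rewrite /m /phi.
  move: (gx _) (gy _) => a b.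
  have h1 := Rabs_triang (fx s - fx s') (fx s' - a).
  have h2 := Rabs_triang (fy s - fy s') (fy s' - b).
  have e1 : (fx s - fx s' + (fx s' - a) = fx s - a)%Re by ring.
  have e2 : (fy s - fy s' + (fy s' - b) = fy s - b)%Re by ring.
  rewrite e1 in h1; rewrite e2 in h2; lra.
have cm : continuity m.
  move=> x eps heps; have h2 : (eps / 2 > 0)%Re by lra.
  have [a1 [a1p ha1]] := cfx x _ h2; have [a2 [a2p ha2]] := cfy x _ h2.
  exists (Rmin a1 a2); split; first exact: Rmin_pos.
  move=> y [Dy hy]; rewrite /= /Rdist in hy *.
  have := ha1 y (conj Dy (Rlt_le_trans _ _ _ hy (Rmin_l _ _))).
  have := ha2 y (conj Dy (Rlt_le_trans _ _ _ hy (Rmin_r _ _))).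
  rewrite /= /Rdist => k2 k1.
  have l1 := mlip y x; have l2 := mlip x y.
  rewrite (Rabs_minus_sym (fx x)) (Rabs_minus_sym (fy x)) in l2.
  by apply: Rabs_def1; lra.
have [s0 [hs0 _]] := continuity_ab_min m 0 1 le01 (fun c _ => cm c).
have mpos : (0 < m s0)%Re.
  rewrite /m /phi; have h1 := Rabs_pos (fx s0 - gx (tau s0)).
  have h2 := Rabs_pos (fy s0 - gy (tau s0)).
  case: (Rlt_dec 0 (phi s0 (tau s0))) => // h; rewrite /phi in h.
  case: (dis s0 (tau s0)); congr pair; apply: Rminus_diag_uniq.
    by case: (Req_dec (fx s0 - gx (tau s0)) 0) => // /Rabs_pos_lt; lra.
  by case: (Req_dec (fy s0 - gy (tau s0)) 0) => // /Rabs_pos_lt; lra.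
exists (m s0 / 2)%Re; first lra.
move=> s t hs ht; have := tauP s t ht; have := hs0 s hs; rewrite -/(m s) /phi /far /sub2 /= => h1 h2.
case: (Rle_dec (m s0 / 2) (Rabs (fx s - gx t))) => h; [by left | right; lra].
Qed.

Lemma grid_ge0_le1 (k N : nat) : 0 < N -> k <= N -> (0 <= INR k / INR N <= 1)%Re.
Proof.
move=> N0 kN; have hN : (0 < INR N)%Re by apply: lt_0_INR; apply/ltP.
have hk := pos_INR k; have kN' : (INR k <= INR N)%Re by apply: le_INR; apply/leP.
split; first by apply: Rmult_le_pos => //; apply: Rlt_le; apply: Rinv_0_lt_compat.
by apply: (Rmult_le_reg_r (INR N)) => //; rewrite /Rdiv Rmult_assoc Rinv_l; lra.
Qed.

Lemma mesh_small (f : R -> R) (eps : R) : continuity f -> (0 < eps)%Re ->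
  exists N0, forall N, N0 <= N -> 0 < N /\ forall k, k < N ->
    (Rabs (f (INR k / INR N) - f (INR k.+1 / INR N)) < eps)%Re.
Proof.
move=> cf he.
have [[d dpos] hd] := @Heine_cor2 f 0 1 (fun x _ => cf x) (mkposreal _ he).
rewrite /= in hd; have [N0 [hN0 /ltP N0p]] := archimed_cor1 d dpos.
exists N0 => N NN0; have Np : 0 < N by apply: leq_trans NN0.
split=> // k kN; apply: hd; [exact: grid_ge0_le1 (ltnW kN) | exact: grid_ge0_le1 |].
have Npos : (0 < INR N)%Re by apply: lt_0_INR; apply/ltP.
have N0pos : (0 < INR N0)%Re by apply: lt_0_INR; apply/ltP.
have le : (INR N0 <= INR N)%Re by apply: le_INR; apply/leP.
rewrite S_INR (_ : (_ - _)%Re = (- / INR N)%Re); last by field; lra.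
rewrite Rabs_Ropp Rabs_pos_eq; last by apply: Rlt_le; apply: Rinv_0_lt_compat.
apply: Rle_lt_trans hN0; exact: Rinv_le_contravar.
Qed.

(** Serves to choose one subdivision that is fine enough for all pairs of disjoint edges. *)
Lemma eventually_forall (I : finType) (P : I -> nat -> Prop) :
  (forall i, exists N0, forall N, N0 <= N -> P i N) ->
  exists N0, forall N, N0 <= N -> forall i, P i N.
Proof.
move=> h; pose g i := proj1_sig (constructive_indefinite_description _ (h i)).
have gP i : forall N, g i <= N -> P i N by exact: proj2_sig (constructive_indefinite_description _ (h i)).
exists (\max_i g i) => N hN i; apply: gP; apply: leq_trans hN.
exact: leq_bigmax.
Qed.

(** * The van Kampen identities for K_{3,3} *)

Section VanKampen.

Variables (gx gy : 'I_3 -> 'I_3 -> R -> R) (A B : 'I_3 -> R * R).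
Hypothesis cx : forall i j, continuity (gx i j).
Hypothesis cy : forall i j, continuity (gy i j).
Hypothesis g0 : forall i j, (gx i j R0, gy i j R0) = A i.
Hypothesis g1 : forall i j, (gx i j R1, gy i j R1) = B j.
Hypothesis dis : forall i j i' j' s t, i != i' -> j != j' ->
  (gx i j s, gy i j s) <> (gx i' j' t, gy i' j' t).

Let pt N i j (k : nat) := (gx i j (INR k / INR N), gy i j (INR k / INR N)).
(** Parity of the crossings of the arc [i j], subdivided into [N] steps, with the horizontal ray
    going right from [z]. *)
Let K N (z : R * R) i j : bool :=
  \big[addb/false]_(k < N) crosses (sub2 (pt N i j k) z) (sub2 (pt N i j k.+1) z).

(** The difference of a point of arc [i j] and a point of arc [i' j'] maps a square to the plane
    minus 0, so its boundary has winding number 0. On two sides arc [i j] is seen from the ends of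
    the other arc; on the remaining two the difference has the opposite sign, and [crosses_sub2C]
    brings in the [lower] terms. *)
Let cell_identity N i j i' j' :=
  K N (A i') i j (+) K N (B j') i j =
  (K N (A i) i' j' (+) (lower (sub2 (A i') (A i)) (+) lower (sub2 (B j') (A i)))) (+)
  (K N (B j) i' j' (+) (lower (sub2 (A i') (B j)) (+) lower (sub2 (B j') (B j)))).

Lemma cell_identityP i j i' j' : i != i' -> j != j' ->
  exists N0, forall N, N0 <= N -> cell_identity N i j i' j'.
Proof.
move=> ii jj.
have [d d0 hd] := disjoint_arcs_gap (cx i j) (cy i j) (cx i' j') (cy i' j')
  (fun s t => @dis _ _ _ _ s t ii jj).
have d2 : (0 < d / 2)%Re by lra.
have [N1 h1] := mesh_small (cx i j) d2; have [N2 h2] := mesh_small (cy i j) d2.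
have [N3 h3] := mesh_small (cx i' j') d2; have [N4 h4] := mesh_small (cy i' j') d2.
exists (maxn (maxn N1 N2) (maxn N3 N4)) => N; rewrite !geq_max => /andP[/andP[l1 l2] /andP[l3 l4]].
have [N0 {}h1] := h1 _ l1; have [_ {}h2] := h2 _ l2.
have [_ {}h3] := h3 _ l3; have [_ {}h4] := h4 _ l4.
have NR : (INR N <> 0)%Re by apply: not_0_INR => e; rewrite e in N0.
have pt0 a b : pt N a b 0 = A a by rewrite /pt -(g0 a b) /= /Rdiv Rmult_0_l.
have ptN a b : pt N a b N = B b by rewrite /pt -(g1 a b) /Rdiv Rinv_r.
pose F k l := sub2 (pt N i j k) (pt N i' j' l).
have farF k l : k <= N -> l <= N -> far d (F k l).
  by move=> kN lN; apply: hd; exact: grid_ge0_le1.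
have stepk k l : k < N -> near d (F k l) (F k.+1 l).
  move=> kN; have := h1 _ kN; have := h2 _ kN; rewrite /near /F /sub2 /pt /=.
  by set a := (_ / _)%Re; set b := (_ / _)%Re; set c := (_ / _)%Re => ? ?; split;
    [rewrite (_ : (_ - _)%Re = (gx i j a - gx i j b)%Re) | rewrite (_ : (_ - _)%Re = (gy i j a - gy i j b)%Re)] => //; ring.
have stepl k l : l < N -> near d (F k l) (F k l.+1).
  move=> lN; have := h3 _ lN; have := h4 _ lN; rewrite /near /F /sub2 /pt /=.
  rewrite (Rabs_minus_sym (gx i' j' _)) (Rabs_minus_sym (gy i' j' _)).
  by set a := (INR k / _)%Re; set b := (INR l / _)%Re; set c := (_ / _)%Re => ? ?; split;
    [rewrite (_ : (_ - _)%Re = (gx i' j' c - gx i' j' b)%Re) | rewrite (_ : (_ - _)%Re = (gy i' j' c - gy i' j' b)%Re)] => //; ring.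
have cells k l : k < N -> l < N ->
    crosses (F k l) (F k.+1 l) (+) crosses (F k l.+1) (F k.+1 l.+1) =
    crosses (F k l) (F k l.+1) (+) crosses (F k.+1 l) (F k.+1 l.+1).
  move=> kN lN; apply: (crosses_cell d0); try apply: farF => //; try exact: ltnW;
  by [apply: stepk | apply: stepl].
have rev k : k <= N -> \big[addb/false]_(l < N) crosses (F k l) (F k l.+1) =
   K N (pt N i j k) i' j' (+)
   (lower (sub2 (A i') (pt N i j k)) (+) lower (sub2 (B j') (pt N i j k))).
  move=> kN; rewrite -(pt0 i' j') -(ptN i' j') /K.
  set z := pt N i j k.
  have farz l : l <= N -> far d (sub2 (pt N i' j' l) z).
    move=> lN; have := farF k l kN lN; rewrite /far /F /sub2 /= -/z.
    by rewrite (Rabs_minus_sym z.1) (Rabs_minus_sym z.2).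
  have nearz l : l < N -> near d (sub2 (pt N i' j' l) z) (sub2 (pt N i' j' l.+1) z).
    have opp (a b c : R) : Rabs (a - b - (c - b))%Re = Rabs (b - a - (b - c))%Re.
      by rewrite -Rabs_Ropp; congr Rabs; ring.
    by move=> lN; have := stepl k l lN; rewrite /near /F -/z /sub2 /= !opp.
  (* The changes of [lower] telescope to the two ends of the arc. *)
  suff tel L : L <= N -> \big[addb/false]_(l < L) crosses (F k l) (F k l.+1) =
      \big[addb/false]_(l < L) crosses (sub2 (pt N i' j' l) z) (sub2 (pt N i' j' l.+1) z) (+)
      (lower (sub2 (pt N i' j' 0) z) (+) lower (sub2 (pt N i' j' L) z)) by exact: tel.
  elim: L => [_|L IH LN]; first by rewrite !big_ord0 addbb.
  rewrite !big_ord_recr /= (IH (ltnW LN)).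
  rewrite /F -/z (crosses_sub2C d0 (farz _ (ltnW LN)) (farz _ LN) (nearz _ LN)).
  by case: (\big[_/_]_(_ < _) _); do 3 case: (lower _); case: (crosses _ _).
have := grid_parity cells.
rewrite (rev 0) // (rev N) // pt0 ptN.
by rewrite /cell_identity /K /F pt0 ptN.
Qed.

(* Summing the cell identities over the 18 pairs of disjoint edges of K_{3,3},
   every [K] occurs twice and the [lower] terms add up to 1. *)
Lemma K33_parity_contradiction : False.
Proof.
pose P (x : 'I_3 * 'I_3 * ('I_3 * 'I_3)) N :=
  x.1.1 != x.2.1 -> x.1.2 != x.2.2 -> cell_identity N x.1.1 x.1.2 x.2.1 x.2.2.
have ev x : exists N0, forall N, N0 <= N -> P x N.
  case: x => [[i j] [i' j']]; rewrite /P /=.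
  case: (boolP (i != i')) => [ii|_]; last by exists 0.
  case: (boolP (j != j')) => [jj|_]; last by exists 0.
  by have [M hM] := cell_identityP ii jj; exists M => N hN _ _; apply: hM.
have [N0 hN] := eventually_forall ev.
have {hN} H i j i' j' := hN N0 (leqnn _) ((i, j), (i', j')).
rewrite /P /= in H.
move: H; rewrite /= /cell_identity; move: (K N0) => K0 H.
pose a0 : 'I_3 := inord 0; pose a1 : 'I_3 := inord 1; pose a2 : 'I_3 := inord 2.
have n01 : a0 != a1 by rewrite -val_eqE /= !inordK.
have n02 : a0 != a2 by rewrite -val_eqE /= !inordK.
have n12 : a1 != a2 by rewrite -val_eqE /= !inordK.
have n10 : a1 != a0 by rewrite eq_sym.
have n20 : a2 != a0 by rewrite eq_sym.
have n21 : a2 != a1 by rewrite eq_sym.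
(* The A-A and A-B [lower] terms occur an even number of times. The B-B terms come in opposite
   pairs, each adding up to 1, one for every choice of {i, i'} and {j, j'}: nine in all, hence 1 mod
   2. *)
have lB j j' : j != j' -> lower (sub2 (B j) (B j')) = ~~ lower (sub2 (B j') (B j)).
  move=> jj; apply: lower_sub2C; rewrite -(g1 a0 j) -(g1 a1 j').
  exact: dis.
(* The identities are put in terms of [xorb], so that [ring] on booleans can add them. *)
have xorE (x y : bool) : x = y -> xorb x y = false by move=> ->; case: y.
have aE x y : x (+) y = xorb x y by case: x; case: y.
have E1 := xorE _ _ (H _ _ _ _ n01 n01).
have E2 := xorE _ _ (H _ _ _ _ n01 n02).
have E3 := xorE _ _ (H _ _ _ _ n01 n12).
have E4 := xorE _ _ (H _ _ _ _ n01 n10).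
have E5 := xorE _ _ (H _ _ _ _ n01 n20).
have E6 := xorE _ _ (H _ _ _ _ n01 n21).
have E7 := xorE _ _ (H _ _ _ _ n02 n01).
have E8 := xorE _ _ (H _ _ _ _ n02 n02).
have E9 := xorE _ _ (H _ _ _ _ n02 n12).
have E10 := xorE _ _ (H _ _ _ _ n02 n10).
have E11 := xorE _ _ (H _ _ _ _ n02 n20).
have E12 := xorE _ _ (H _ _ _ _ n02 n21).
have E13 := xorE _ _ (H _ _ _ _ n12 n01).
have E14 := xorE _ _ (H _ _ _ _ n12 n02).
have E15 := xorE _ _ (H _ _ _ _ n12 n12).
have E16 := xorE _ _ (H _ _ _ _ n12 n10).
have E17 := xorE _ _ (H _ _ _ _ n12 n20).
have E18 := xorE _ _ (H _ _ _ _ n12 n21).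
have L1 := lB _ _ n01; have L2 := lB _ _ n02; have L3 := lB _ _ n12.
have L xx : ~~ xx = xorb xx true by case: xx.
rewrite !aE ?L1 ?L2 ?L3 !L in E1 E2 E3 E4 E5 E6 E7 E8 E9 E10 E11 E12 E13 E14 E15 E16 E17 E18.
have X x y : x = false -> y = false -> xorb x y = false by move=> -> ->.
have {E1 E2 E3 E4 E5 E6 E7 E8 E9 E10 E11 E12 E13 E14 E15 E16 E17 E18} E :=
  X _ _ E1 (X _ _ E2 (X _ _ E3 (X _ _ E4 (X _ _ E5 (X _ _ E6 (X _ _ E7 (X _ _ E8 (X _ _ E9
  (X _ _ E10 (X _ _ E11 (X _ _ E12 (X _ _ E13 (X _ _ E14 (X _ _ E15 (X _ _ E16
  (X _ _ E17 E18)))))))))))))))).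
suff : true = false by [].
rewrite -E; ring.
Qed.
End VanKampen.

(** * Fat drawings *)

(* A drawing whose vertices are fattened to path-connected sets; unlike planar
   drawings, these are trivially stable under contraction of an edge. *)
Definition fat_drawing (T : finType) (V : {set T}) (e : rel T) : Prop :=
  exists (S : T -> R * R -> Prop) (E : T -> T -> R * R -> Prop),
  [/\ forall v, v \in V -> path_connected (S v),
      forall u v, u \in V -> v \in V -> e u v ->
        [/\ path_connected (E u v), exists2 p, S u p & E u v p
          & exists2 p, S v p & E u v p],
      forall u v p, u \in V -> v \in V -> u != v -> S u p -> ~ S v p,
      forall u v w p, u \in V -> v \in V -> w \in V -> e u v ->
        w != u -> w != v -> E u v p -> ~ S w p
    & forall u v w x p, u \in V -> v \in V -> w \in V -> x \in V ->
        e u v -> e w x -> u != w -> u != x -> v != w -> v != x ->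
        E u v p -> ~ E w x p].

Definition contract (T : eqType) (e : rel T) (x y : T) : rel T :=
  fun u v => (u != v) && [|| e u v, (u == x) && e y v | (v == x) && e u y].

Lemma fat_drawing_sub (T : finType) (V V' : {set T}) (e e' : rel T) :
  V' \subset V -> {in V' &, subrel e' e} -> fat_drawing V e -> fat_drawing V' e'.
Proof.
move=> /subsetP sV se [S [E [h1 h2 h3 h4 h5]]]; exists S, E; split.
- by move=> v /sV; exact: h1.
- by move=> u v uV vV euv; apply: h2; [exact: sV | exact: sV | exact: se].
- by move=> u v p /sV uV /sV vV; exact: h3.
- by move=> u v w p uV vV wV euv; apply: h4; [exact: sV | exact: sV | exact: sV | exact: se].
- move=> u v w x p uV vV wV xV euv ewx.
  by apply: h5; [exact: sV | exact: sV | exact: sV | exact: sV | exact: se | exact: se].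
Qed.

(** The merged vertex receives [S x], [E x y] and [S y] together. A point of a new set lies in an
    old set above it under the contraction map [phi], or on the absorbed edge; distinct images have
    distinct preimages, so disjointness pulls back to the old drawing. *)
Lemma fat_drawing_contract (T : finType) (V : {set T}) (e : rel T) (x y : T) :
  x \in V -> y \in V -> x != y -> e x y ->
  fat_drawing V e -> fat_drawing (V :\ y) (contract e x y).
Proof.
move=> xV yV xy exy [S [E [h1 h2 h3 h4 h5]]].
pose phi v := if v == y then x else v.
pose S' v p := if v == x then (S x p \/ E x y p) \/ S y p else S v p.
pose E' u v := if e u v then E u v else if u == x then E y v else E u y.
have S'P w p : w \in V :\ y -> S' w p ->
    (exists w0, [/\ w0 \in V, phi w0 = w & S w0 p]) \/ (w = x /\ E x y p).
  rewrite !inE => /andP[wy wV]; rewrite /S'; case: eqP => [->|_]; last first.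
    by left; exists w; rewrite /phi (negbTE wy).
  case=> [[h|h]|h]; [left; exists x | by right | left; exists y].
    by rewrite /phi (negbTE xy).
  by rewrite /phi eqxx.
have E'P u v p : u \in V :\ y -> v \in V :\ y -> contract e x y u v -> E' u v p ->
    exists u0 v0, [/\ u0 \in V, v0 \in V, e u0 v0 & [/\ phi u0 = u, phi v0 = v & E u0 v0 p]].
  rewrite !inE => /andP[uy uV] /andP[vy vV] /andP[uv]; rewrite /E'.
  case: ifP => [euv _ h|_] /=.
    by exists u, v; rewrite /phi (negbTE uy) (negbTE vy).
  case: (eqVneq u x) => [ux | _] /=; last first.
    by move=> /andP[/eqP -> euy] h; exists u, y; rewrite /phi eqxx (negbTE uy).
  have /negbTE -> /= : v != x by rewrite -ux eq_sym.
  by rewrite orbF => eyv h; exists y, v; rewrite /phi eqxx (negbTE vy) ux.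
have phix : phi x = x by rewrite /phi (negbTE xy).
have phiy : phi y = x by rewrite /phi eqxx.
have phi_neq a b : phi a != phi b -> a != b by apply: contra_neq => ->.
exists S', E'; split.
- move=> v; rewrite !inE => /andP[vy vV]; rewrite /S'; case: eqP => // _; last exact: h1.
  have [cE [p Sxp Ep] [q Syq Eq]] := h2 _ _ xV yV exy.
  apply: (path_connected_setU (m := q)) => //; [|exact: h1|by right].
  by apply: (path_connected_setU (m := p)) => //; exact: h1.
- move=> u v; rewrite !inE => /andP[uy uV] /andP[vy vV] /andP[uv]; rewrite /E' /S'.
  case: (boolP (e u v)) => [euv _|_] /=.
    have [cE [p Sp Ep] [q Sq Eq]] := h2 _ _ uV vV euv; split=> //.
      by exists p => //; case: eqP Sp => // ->; tauto.
    by exists q => //; case: eqP Sq => // ->; tauto.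
  case: (eqVneq u x) => [ux | ux] /=.
    have /negbTE -> /= : v != x by rewrite -ux eq_sym.
    rewrite orbF => eyv; have [cE [p Sp Ep] [q Sq Eq]] := h2 _ _ yV vV eyv.
    by split=> //; [exists p => //; right | exists q].
  case/andP=> /eqP -> euy; rewrite eqxx.
  have [cE [p Sp Ep] [q Sq Eq]] := h2 _ _ uV yV euy.
  by split=> //; [exists p | exists q => //; right].
- move=> u v p uV vV uv /(S'P _ _ uV) hu /(S'P _ _ vV) hv.
  case: hu hv => [[u0 [u0V eu Su]] | [ux Ep]] [[v0 [v0V ev Sv]] | [vx Ep']].
  + by apply: (h3 u0 v0 p) => //; apply: phi_neq; rewrite eu ev.
  + apply: (h4 x y u0 p) => //; apply: phi_neq; rewrite eu ?phix ?phiy -vx //.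
  + apply: (h4 x y v0 p) => //; apply: phi_neq; rewrite ev ?phix ?phiy -ux // eq_sym //.
  + by rewrite ux vx eqxx in uv.
- move=> u v w p uV vV wV euv wu wv /(E'P _ _ _ uV vV euv) [u0 [v0 [u0V v0V e0 [eu ev Ep]]]].
  move=> /(S'P _ _ wV) [[w0 [w0V ew Sw]] | [wx Exy]].
    by apply: (h4 u0 v0 w0 p) => //; apply: phi_neq; rewrite ew ?eu ?ev.
  by apply: (h5 u0 v0 x y p) => //; apply: phi_neq; rewrite ?eu ?ev ?phix ?phiy -wx eq_sym.
- move=> u v w z p uV vV wV zV euv ewz uw uz vw vz.
  move=> /(E'P _ _ _ uV vV euv) [u0 [v0 [u0V v0V e0 [eu ev Ep]]]].
  move=> /(E'P _ _ _ wV zV ewz) [w0 [z0 [w0V z0V e1 [ew ez Ep']]]].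
  by apply: (h5 u0 v0 w0 z0 p) => //; apply: phi_neq; rewrite ?eu ?ev ?ew ?ez.
Qed.

(** A point chosen in each vertex set turns the drawing into arcs: [A i] is joined to [B j] inside
    the union of two vertex sets and an edge set. Such unions are disjoint for disjoint edges,
    against [K33_parity_contradiction]. *)
Lemma fat_drawing_K33 (T : finType) (V : {set T}) (e : rel T) (a b : 'I_3 -> T) :
  injective a -> injective b -> (forall i j, a i != b j) ->
  (forall i, a i \in V) -> (forall j, b j \in V) -> (forall i j, e (a i) (b j)) ->
  ~ fat_drawing V e.
Proof.
move=> ia ib ab aV bV eab [S [E [h1 h2 h3 h4 h5]]].
pose i0 : 'I_3 := ord0.
have exA i : exists p, S (a i) p.
  by have [_ [p Sp _] _] := h2 _ _ (aV i) (bV i0) (eab i i0); exists p.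
have exB j : exists p, S (b j) p.
  by have [_ _ [p Sp _]] := h2 _ _ (aV i0) (bV j) (eab i0 j); exists p.
pose A i := proj1_sig (constructive_indefinite_description _ (exA i)).
pose B j := proj1_sig (constructive_indefinite_description _ (exB j)).
have AS i : S (a i) (A i) := proj2_sig (constructive_indefinite_description _ (exA i)).
have BS j : S (b j) (B j) := proj2_sig (constructive_indefinite_description _ (exB j)).
pose U i j p := (S (a i) p \/ E (a i) (b j) p) \/ S (b j) p.
have ex ij : exists g : (R -> R) * (R -> R),
    [/\ continuity g.1, continuity g.2, (g.1 R0, g.2 R0) = A ij.1,
        (g.1 R1, g.2 R1) = B ij.2 & forall t, U ij.1 ij.2 (g.1 t, g.2 t)].
  case: ij => i j /=.
  have [cE [p Sp Ep] [q Sq Eq]] := h2 _ _ (aV i) (bV j) (eab i j).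
  have cU : path_connected (U i j).
    apply: (path_connected_setU (m := q)) => //; [|exact: h1|by right].
    by apply: (path_connected_setU (m := p)) => //; exact: h1.
  have [gx [gy hg]] := cU (A i) (B j) (or_introl (or_introl (AS i))) (or_intror (BS j)).
  by exists (gx, gy).
pose g ij := proj1_sig (constructive_indefinite_description _ (ex ij)).
have gP ij := proj2_sig (constructive_indefinite_description _ (ex ij)).
apply: (@K33_parity_contradiction (fun i j => (g (i, j)).1) (fun i j => (g (i, j)).2) A B).
- by move=> i j; have [] := gP (i, j).
- by move=> i j; have [] := gP (i, j).
- by move=> i j; have [] := gP (i, j).
- by move=> i j; have [] := gP (i, j).
move=> i j i' j' s t ii jj.
have [_ _ _ _ /(_ s)] := gP (i, j); have [_ _ _ _ /(_ t)] := gP (i', j').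
rewrite -/(g _) -/(g _) /=; set q := (_, _); set p := (_, _) => Uq Up pq.
rewrite {}pq in Up.
have aa : a i != a i' by rewrite (inj_eq ia).
have bb : b j != b j' by rewrite (inj_eq ib).
case: Up Uq => [[Sp|Ep]|Sp] [[Sq|Eq]|Sq].
- by apply: (h3 (a i) (a i') q).
- by apply: (h4 (a i') (b j') (a i) q).
- by apply: (h3 (a i) (b j') q).
- by apply: (h4 (a i) (b j) (a i') q) => //; rewrite eq_sym.
- by apply: (h5 (a i) (b j) (a i') (b j') q) => //; rewrite eq_sym.
- by apply: (h4 (a i) (b j) (b j') q) => //; rewrite eq_sym.
- by apply: (h3 (a i') (b j) q).
- by apply: (h4 (a i') (b j') (b j) q) => //; rewrite eq_sym.
- by apply: (h3 (b j) (b j') q).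
Qed.

(** Vertices become single points and edges closed arcs. [clamp] is applied because a drawing
    restricts the arcs on [0,1] only, and [E] splits on the order of its ends because arcs are given
    for u < v only. *)
Lemma planar_fat_drawing (n : nat) (e : rel 'I_n) :
  simple_graph e -> planar e -> fat_drawing [set: 'I_n] e.
Proof.
move=> [irr sym] [px [py [gx [gy [inj [arcs cross]]]]]].
pose S v p := p = (px v, py v).
pose E (u v : 'I_n) p := exists s, p = if u < v then (gx u v (clamp s), gy u v (clamp s))
  else (gx v u (clamp s), gy v u (clamp s)).
have u01 t : unit_int (clamp t) := clamp_ge0_le1 t.
have inj' u v : (px u, py u) = (px v, py v) -> u = v by case; exact: inj.
have WLOG u v : e u v -> exists u0 v0 : 'I_n, [/\ u0 < v0, e u0 v0,
    (u = u0 /\ v = v0) \/ (u = v0 /\ v = u0)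
    & forall p, E u v p <-> exists s, p = (gx u0 v0 (clamp s), gy u0 v0 (clamp s))].
  move=> euv; case: (ltngtP u v) => [uv|vu|/ord_inj uv].
  - by exists u, v; split=> //; [left | rewrite /E uv].
  - by exists v, u; split=> //; [rewrite sym | right | rewrite /E ltnNge (ltnW vu)].
  - by rewrite uv (negbTE (irr v)) in euv.
have sub (a b : 'I_n) s : a < b -> e a b -> s = R0 \/ s = R1 ->
    (gx a b s, gy a b s) = (px a, py a) \/ (gx a b s, gy a b s) = (px b, py b).
  move=> ab eab hs; have [_ [_ [x0 [y0 [x1 [y1 _]]]]]] := arcs a b ab eab.
  by case: hs => ->; [left; rewrite x0 y0 | right; rewrite x1 y1].
exists S, E; split.
- by move=> v _ p q -> ->; exists (fun=> px v), (fun=> py v); split=> //; apply: continuity_const => ? ?.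
- move=> u v _ _ /WLOG [a [b [ab eab uvab EP]]].
  have [cx [cy [gx0 [gy0 [gx1 [gy1 _]]]]]] := arcs a b ab eab.
  have Ea : E u v (px a, py a).
    by apply/EP; exists R0; rewrite clamp_le0 ?gx0 ?gy0 //; lra.
  have Eb : E u v (px b, py b).
    by apply/EP; exists R1; rewrite clamp_ge1 ?gx1 ?gy1 //; lra.
  split; last 2 first.
  + by case: uvab => [[uE _]|[uE _]]; [exists (px a, py a) | exists (px b, py b)] => //; rewrite /S uE.
  + by case: uvab => [[_ vE]|[_ vE]]; [exists (px b, py b) | exists (px a, py a)] => //; rewrite /S vE.
  move=> p q /EP [s ->] /EP [t ->].
  pose f (h : 'I_n -> 'I_n -> R -> R) (z : R) := h a b (clamp ((clamp t - clamp s) * z + clamp s)).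
  have cf (h : 'I_n -> 'I_n -> R -> R) : continuity (h a b) -> continuity (f h).
    exact: continuity_clamp_affine.
  exists (f gx), (f gy); split; [exact: cf | exact: cf | | |].
  + by rewrite /f Rmult_0_r Rplus_0_l (clamp_id (u01 s)).
  + rewrite /f Rmult_1_r (_ : (_ + _)%Re = clamp t); last by ring.
    by rewrite (clamp_id (u01 t)).
  + by move=> z; apply/EP; exists ((clamp t - clamp s) * z + clamp s)%Re.
- by move=> u v p _ _ /eqP uv -> /inj'.
- move=> u v w p _ _ _ /WLOG [a [b [ab eab uvab EP]]] wu wv /EP [s ->] h.
  have [_ [_ [_ [_ [_ [_ [_ hw]]]]]]] := arcs a b ab eab.
  have hs : clamp s = R0 \/ clamp s = R1 by apply: (hw _ w (u01 s)); case: h.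
  move: wu wv; case: (sub a b _ ab eab hs) => e'; rewrite h in e'; move/inj': e' => ->;
  by case: uvab => [[-> ->]|[-> ->]]; rewrite eqxx.
- move=> u v w x p _ _ _ _ /WLOG [a [b [ab eab uvab EP]]] /WLOG [c [d [cd ecd wxcd EP']]].
  move=> uw ux vw vx /EP [s ->] /EP' [t h].
  have ne : (a, b) <> (c, d).
    by case=> ac bd; move: uw ux; rewrite ac bd in uvab;
      case: uvab => [[-> _]|[-> _]]; case: wxcd => [[-> ->]|[-> ->]]; rewrite eqxx.
  case: (h) => hx hy.
  (* A common point is an end of both arcs, hence a vertex common to the two edges. *)
  have [hs ht] := cross a b c d (clamp s) (clamp t) ab eab cd ecd ne (u01 s) (u01 t) hx hy.
  have := sub a b _ ab eab hs; have := sub c d _ cd ecd ht; rewrite h.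
  move: uw ux vw vx.
  case: uvab => [[-> ->]|[-> ->]]; case: wxcd => [[-> ->]|[-> ->]] n1 n2 n3 n4;
  case=> ->; case=> /inj' e'; move: n1 n2 n3 n4; rewrite e' eqxx ?andbF //.
Qed.

(** * Minors and edge density *)

From mathcomp Require Import zify ring lra.
Import Order.TTheory.

(** The class is abstract because the induction in [dense_biclique_minor] replaces [C] by the graphs
    whose join with an apex is in [C]. *)
Definition minor_closed (T : finType) (C : {set T} -> rel T -> Prop) : Prop :=
  (forall (V V' : {set T}) (e e' : rel T), V' \subset V -> {in V' &, subrel e' e} -> C V e -> C V' e') /\
  (forall (V : {set T}) (e : rel T) x y, x \in V -> y \in V -> x != y -> e x y -> C V e ->
     C (V :\ y) (contract e x y)).

(* Counts ordered pairs, so each edge inside [V] twice. *)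
Definition arcs (T : finType) (V : {set T}) (e : rel T) : nat :=
  \sum_(u in V) \sum_(v in V) e u v.

Lemma contract_sym (T : eqType) (e : rel T) (x y : T) : symmetric e -> symmetric (contract e x y).
Proof.
move=> sym u v; rewrite /contract eq_sym (sym v u) (sym u y) (sym y v).
by congr (_ && (_ || _)); rewrite orbC.
Qed.

Lemma contract_irr (T : eqType) (e : rel T) (x y : T) : irreflexive (contract e x y).
Proof. by move=> u; rewrite /contract eqxx. Qed.

Lemma arcsD1 (T : finType) (V : {set T}) (e : rel T) (x : T) :
  symmetric e -> irreflexive e -> x \in V ->
  arcs V e = arcs (V :\ x) e + 2 * \sum_(v in V :\ x) e x v.
Proof.
move=> sym irr xV; rewrite /arcs (big_setD1 x xV) /= (big_setD1 x xV) /= irr add0n.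
have -> : \sum_(u in V :\ x) \sum_(v in V) e u v =
    \sum_(u in V :\ x) (e x u + \sum_(v in V :\ x) e u v).
  by apply: eq_bigr => u _; rewrite (big_setD1 x xV) /= sym.
by rewrite big_split /=; lia.
Qed.

(** Contraction loses the edge [x y] and one of the two edges to each common neighbour; every loss
    counts twice in [arcs]. *)
Lemma arcs_contract (T : finType) (V : {set T}) (e : rel T) (x y : T) :
  symmetric e -> irreflexive e -> x \in V -> y \in V -> x != y -> e x y ->
  arcs V e = arcs (V :\ y) (contract e x y) + 2 + 2 * \sum_(v in V) (e x v && e y v).
Proof.
move=> sym irr xV yV xy exy.
have xVy : x \in V :\ y by rewrite !inE xy.
rewrite (arcsD1 sym irr yV) (arcsD1 sym irr xVy).
rewrite (arcsD1 (contract_sym x y sym) (contract_irr e x y) xVy).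
set W := V :\ y :\ x.
have -> : arcs W (contract e x y) = arcs W e.
  apply: eq_bigr => u; rewrite !inE => /andP[ux _]; apply: eq_bigr => v.
  rewrite !inE => /andP[vx _]; rewrite /contract (negbTE ux) (negbTE vx) /= orbF.
  by case: eqP => // ->; rewrite irr.
rewrite (big_setD1 x xVy) /= (sym y x) exy -/W.
rewrite (big_setD1 y yV) /= irr andbF add0n (big_setD1 x xVy) /= irr add0n -/W.
have -> : \sum_(v in W) contract e x y x v = \sum_(v in W) (e x v || e y v).
  apply: eq_bigr => v; rewrite !inE => /andP[vx _].
  by rewrite /contract eq_sym vx eqxx (negbTE vx) /= orbF.
have : \sum_(v in W) e x v + \sum_(v in W) e y v =
   \sum_(v in W) (e x v || e y v) + \sum_(v in W) (e x v && e y v).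
  by rewrite -!big_split; apply: eq_bigr => v _ /=; case: (e x v); case: (e y v).
lia.
Qed.

Definition add_apex (T : eqType) (e : rel T) (x : T) : rel T :=
  fun u v => (u != v) && [|| u == x, v == x | e u v].

(** Contracting an edge that avoids the apex commutes with adding the apex. *)
Lemma minor_closed_apex (T : finType) (C : {set T} -> rel T -> Prop) (x : T) :
  minor_closed C ->
  minor_closed (fun W f => x \notin W /\ C (x |: W) (add_apex f x)).
Proof.
move=> [Csub Ccon]; split.
  move=> V V' e e' sV se [xV CV]; split.
    by apply: contra xV; apply: (subsetP sV).
  apply: Csub CV; first exact: setUS.
  move=> u v; rewrite /add_apex !inE => uV vV /andP[-> /=].
  case: eqP uV => //= _ uV; case: eqP vV => //= _ vV; exact: se.
move=> V e y z yV zV yz eyz [xV CV].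
have xy : x != y by apply: contraNneq xV => ->.
have xz : x != z by apply: contraNneq xV => ->.
split; first by rewrite !inE (negbTE xV) andbF.
have eyz' : add_apex e x y z by rewrite /add_apex yz eyz !orbT.
have yV' : y \in x |: V by rewrite !inE yV orbT.
have zV' : z \in x |: V by rewrite !inE zV orbT.
apply: Csub (Ccon _ _ _ _ yV' zV' yz eyz' CV).
  apply/subsetP => u; rewrite !inE => /orP[/eqP ->|/andP[-> ->]]; rewrite ?eqxx ?orbT //.
  by rewrite xz.
move=> u v; rewrite !inE /add_apex /contract => uV vV /andP[uv].
rewrite uv /=; case: (eqVneq u x) => [//|ux] /=.
case: (eqVneq v x) => [//|vx] /=.
rewrite (negbTE ux) (negbTE vx) /= in uV vV.
case/andP: uV => uz _; case/andP: vV => vz _.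
by rewrite (eq_sym z v) vz uz [z == x]eq_sym (negbTE xz).
Qed.

Lemma subset_card_exists (T : finType) (X : {set T}) (k : nat) :
  k <= #|X| -> exists2 Y : {set T}, Y \subset X & #|Y| = k.
Proof.
move=> kX; exists [set x in take k (enum X)].
  by apply/subsetP => x; rewrite inE => /mem_take; rewrite mem_enum.
rewrite cardsE; apply/eqP; rewrite (card_uniqP _) ?take_uniq ?enum_uniq //.
by rewrite size_take -cardE; case: ltngtP kX => // ->.
Qed.

Lemma sum_mem_nat (T : finType) (V : {set T}) (P : pred T) :
  \sum_(v in V) (P v : nat) = #|[set v in V | P v]|.
Proof.
by rewrite -sum1dep_card big_mkcondr /=; apply: eq_bigr => v _; case: (P v).
Qed.

(* Mader's argument: contract edges lying in few triangles; when none is left,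
   the neighbourhood of a vertex is dense enough for the induction. *)
Lemma dense_biclique_minor (s : nat) (T : finType) (C : {set T} -> rel T -> Prop)
    (V : {set T}) (e : rel T) :
  minor_closed C -> symmetric e -> irreflexive e -> C V e ->
  0 < #|V| -> 3 * 2 ^ s * #|V| <= arcs V e ->
  exists (V' : {set T}) (e' : rel T) (A B : {set T}),
    [/\ C V' e', A \subset V', B \subset V', [disjoint A & B] &
     [/\ #|A| = s.+1, #|B| = 3 & {in A & B, forall a b, e' a b}]].
Proof.
elim: s C V e => [|s IHs] C V e mC sym irr CV V0 dense.
  (* For [s = 0] the average degree is at least 3, so some vertex is the centre of a K_{1,3}. *)
  have [u uV hu] : exists2 u, u \in V & 3 <= #|[set v in V | e u v]|.
    apply/exists_inP; apply: contraLR dense; rewrite negb_exists => /forallP h.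
    rewrite -ltnNge expn0 muln1 /arcs.
    have le u : u \in V -> \sum_(v in V) e u v <= 2.
      by move=> uV; have := h u; rewrite uV sum_mem_nat -ltnNge.
    apply: leq_ltn_trans (leq_sum _ _) _; first exact: le.
    by rewrite sum_nat_const; lia.
  have [Y sY cY] := subset_card_exists hu.
  exists V, e, [set u], Y; split=> //.
  - by rewrite sub1set.
  - by apply: subset_trans sY _; apply/subsetP => v; rewrite inE => /andP[].
  - rewrite disjoints1; apply/negP => /(subsetP sY); rewrite inE irr andbF //.
  split; rewrite ?cards1 // => a b /set1P -> /(subsetP sY); rewrite inE => /andP[] //.
have [m] := ubnP #|V|; elim: m V e sym irr CV V0 dense => // m IHm V e sym irr CV V0 dense.
rewrite ltnS => Vm.
case: (boolP [exists x in V, exists y in V, e x y &&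
    (\sum_(v in V) (e x v && e y v) < 3 * 2 ^ s)]).
  case/exists_inP=> x xV /exists_inP [y yV /andP[exy few]].
  have xy : x != y by apply: contraTneq exy => ->; rewrite irr.
  have cV : #|V| = #|V :\ y|.+1 by rewrite (cardsD1 y) yV.
  apply: (IHm (V :\ y) (contract e x y)).
  - exact: contract_sym.
  - exact: contract_irr.
  - exact: mC.2.
  - by apply/card_gt0P; exists x; rewrite !inE xy.
  (* The contraction costs at most [2 * (3 * 2 ^ s)] arcs, exactly what the loss of one vertex
     permits. *)
  - move: dense; rewrite (arcs_contract sym irr xV yV xy exy) cV expnS; lia.
  - by move: Vm; rewrite cV.
rewrite negb_exists_in => /forall_inP many.
have {}many x y : x \in V -> y \in V -> e x y -> 3 * 2 ^ s <= \sum_(v in V) (e x v && e y v).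
  move=> xV yV exy; have := many x xV; rewrite negb_exists_in => /forall_inP /(_ y yV).
  by rewrite exy /= -leqNgt.
have [x xV [y yV exy]] : exists2 x, x \in V & exists2 y, y \in V & e x y.
  have : 0 < arcs V e by apply: leq_trans dense; rewrite !muln_gt0 expn_gt0 V0.
  rewrite lt0n sum_nat_eq0 negb_forall_in => /exists_inP [x xV].
  rewrite sum_nat_eq0 negb_forall_in => /exists_inP [y yV exy].
  by exists x => //; exists y => //; move: exy; case: (e x y).
(* Each neighbour of [x] has at least [3 * 2 ^ s] neighbours inside [N], so [N] is dense enough for
   [s]. The minor found there extends by the apex [x], which joins the side [A]. *)
pose N := [set v in V | e x v].
have xN : x \notin N by rewrite inE irr andbF.
have NP u : (u \in N) = (u \in V) && e x u by rewrite inE.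
have [|||V' [f [A [B [[xV' CV'] sA sB dAB [cA cB eAB]]]]]] :=
   IHs _ N e (minor_closed_apex x mC) sym irr.
- split=> //; apply: mC.1 CV.
    by apply/subsetP => u; rewrite !inE => /orP[/eqP ->|/andP[]].
  move=> u v; rewrite !inE /add_apex => uN vN /andP[uv].
  case: eqP uN uv => [-> _ xv|_ /= uN uv] /=.
    by move: vN; rewrite eq_sym (negbTE xv) /= => /andP[].
  case: eqP vN uv => [-> _ _|//] _; case/andP: uN => _; by rewrite sym.
- by apply/card_gt0P; exists y; rewrite inE yV.
- rewrite mulnC -sum_nat_const /arcs; apply: leq_sum => u.
  rewrite inE => /andP[uV exu]; apply: leq_trans (many x u xV uV exu) _.
  rewrite !sum_mem_nat; apply: subset_leq_card; apply/subsetP => v.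
  by rewrite !inE => /and3P[-> -> ->].
exists (x |: V'), (add_apex f x), (x |: A), B; split=> //.
- exact: setUS.
- by apply: subset_trans sB (subsetUr _ _).
- rewrite disjoint_sym; apply/pred0P => b /=; rewrite !inE.
  case: (boolP (b \in B)) => //= bB; apply/negbTE; rewrite negb_or.
  rewrite (disjointFl dAB bB) andbT.
  by apply: contraNneq xV' => <-; apply: (subsetP sB).
split=> //.
  by rewrite cardsU1 cA (contra _ xV') //; apply: (subsetP sA).
move=> a b; rewrite !inE => /orP[/eqP ->|aA] bB; rewrite /add_apex.
  by rewrite eqxx andbT; apply: contraNneq xV' => ->; apply: (subsetP sB).
rewrite eAB // !orbT andbT.
by apply: contraTneq aA => ->; rewrite (disjointFl dAB bB).
Qed.

Lemma fat_drawing_no_biclique (T : finType) (V : {set T}) (e : rel T) (A B : {set T}) :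
  A \subset V -> B \subset V -> [disjoint A & B] -> #|A| = 3 -> #|B| = 3 ->
  {in A & B, forall a b, e a b} -> ~ fat_drawing V e.
Proof.
move=> sA sB dAB cA cB eAB.
pose a (i : 'I_3) := enum_val (cast_ord (esym cA) i).
pose b (i : 'I_3) := enum_val (cast_ord (esym cB) i).
have aA i : a i \in A by apply: enum_valP.
have bB i : b i \in B by apply: enum_valP.
apply: (@fat_drawing_K33 _ _ _ a b).
- by move=> i j /enum_val_inj /cast_ord_inj.
- by move=> i j /enum_val_inj /cast_ord_inj.
- by move=> i j; apply: contraTneq (aA i) => ->; rewrite (disjointFl dAB (bB j)).
- by move=> i; apply: (subsetP sA).
- by move=> i; apply: (subsetP sB).
- by move=> i j; apply: eAB.
Qed.

(** The case [s = 2] of the minor bound, with 12 = 3 * 2^2, would produce K_{3,3}. *)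
Lemma fat_drawing_sparse (T : finType) (V : {set T}) (e : rel T) :
  symmetric e -> irreflexive e -> fat_drawing V e -> arcs V e <= 12 * #|V|.
Proof.
move=> sym irr fat; rewrite leqNgt; apply/negP => dense.
have mC : minor_closed (@fat_drawing T).
  split; first by move=> *; apply: fat_drawing_sub; eassumption.
  by move=> *; apply: fat_drawing_contract.
have [||V' [e' [A [B [fat' sA sB dAB [cA cB eAB]]]]]] :=
  @dense_biclique_minor 2 _ _ _ _ mC sym irr fat.
- rewrite lt0n; apply: contraTneq dense => /eqP; rewrite cards_eq0 => /eqP ->.
  by rewrite /arcs big_set0.
- exact: ltnW.
exact: (fat_drawing_no_biclique sA sB dAB cA cB eAB).
Qed.

(** * Subinvariant vectors of sparse graphs *)

Section SparseK33Free.

Variables (T : finType) (e : rel T).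
Hypothesis sym : symmetric e.
Hypothesis irr : irreflexive e.
Hypothesis sparse : forall V : {set T}, arcs V e <= 12 * #|V|.
Hypothesis K33free : forall a b c : T, a != b -> a != c -> b != c ->
  #|[set u | [&& e a u, e b u & e c u]]| <= 2.

Definition nbr (v : T) : {set T} := [set u | e v u].

Lemma in_nbr u v : (u \in nbr v) = e v u.
Proof. by rewrite inE. Qed.

Lemma card_nbrI v (L : {set T}) : #|nbr v :&: L| = \sum_(w in L) e v w.
Proof. by rewrite sum_mem_nat; apply: eq_card => w; rewrite !inE andbC. Qed.

Lemma sum_card_nbrI (X Y : {set T}) :
  \sum_(u in X) #|nbr u :&: Y| <= 12 * (#|X| + #|Y|).
Proof.
apply: leq_trans (_ : arcs (X :|: Y) e <= _); last first.
  by apply: leq_trans (sparse _) _; rewrite leq_mul2l cardsU leq_subr.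
rewrite /arcs (big_setID X (A := X :|: Y)) /= setUK; apply: leq_trans (leq_addr _ _).
apply: leq_sum => u _; rewrite card_nbrI (big_setID Y (A := X :|: Y)) /= setIC setKU.
exact: leq_addr.
Qed.

Lemma sum_card_nbr (X : {set T}) : \sum_(u in X) #|nbr u| <= 12 * #|T|.
Proof.
apply: leq_trans (_ : arcs [set: T] e <= _); last by rewrite -cardsT.
rewrite /arcs (big_setID X (A := setT)) /= setTI; apply: leq_trans (leq_addr _ _).
by apply: leq_sum => u _; rewrite -card_nbrI setIT.
Qed.

(* k <= 1 + C(k,2), and by K_{3,3}-freeness each pair in L is counted at most twice *)
Lemma sum_card_nbrI_nbr (v : T) (L : {set T}) : v \notin L ->
  \sum_(u in nbr v) #|nbr u :&: L| <= #|nbr v| + #|L| ^ 2.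
Proof.
move=> vL; pose k u := #|nbr u :&: L|.
(* The squares count pairs [(w, w')] in [L]: the diagonal returns the sum of [k], and off it [v],
   [w], [w'] are three distinct vertices with at most two common neighbours. *)
have k2 : \sum_(u in nbr v) k u ^ 2 <= \sum_(u in nbr v) k u + 2 * #|L| ^ 2.
  have -> : \sum_(u in nbr v) k u ^ 2 =
      \sum_(w in L) \sum_(w' in L) \sum_(u in nbr v) (e u w && e u w').
    rewrite exchange_big /=; under [RHS]eq_bigr => w _ do rewrite exchange_big /=.
    rewrite exchange_big /=; apply: eq_bigr => u _.
    rewrite /k card_nbrI expnS expn1 big_distrlr /= exchange_big /=.
    by apply: eq_bigr => w _; apply: eq_bigr => w' _; case: (e u w'); case: (e u w).
  have -> : \sum_(u in nbr v) k u = \sum_(w in L) \sum_(u in nbr v) (e u w && e u w).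
    rewrite exchange_big /=; apply: eq_bigr => u _; rewrite /k card_nbrI.
    by apply: eq_bigr => w _; rewrite andbb.
  have -> : 2 * #|L| ^ 2 = \sum_(w in L) \sum_(w' in L) 2.
    by rewrite !sum_nat_const; lia.
  rewrite -big_split /=; apply: leq_sum => w wL.
  rewrite (big_setD1 w wL) /= leq_add2l.
  apply: leq_trans (_ : \sum_(w' in L :\ w) 2 <= _); last first.
    by rewrite [X in _ <= X](big_setD1 w wL) leq_addl.
  apply: leq_sum => w'; rewrite !inE => /andP[w'w w'L].
  have vw : v != w by apply: contraNneq vL => ->.
  have vw' : v != w' by apply: contraNneq vL => ->.
  rewrite eq_sym in w'w.
  apply: leq_trans (K33free vw vw' w'w).
  rewrite sum_mem_nat; apply: subset_leq_card; apply/subsetP => u; rewrite !inE.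
  by rewrite (sym u w) (sym u w').
(* Summation of [(k - 1)(k - 2) >= 0]. *)
have k3 : 3 * \sum_(u in nbr v) k u <= #|nbr v| * 2 + \sum_(u in nbr v) k u ^ 2.
  rewrite -sum_nat_const -big_split big_distrr /=.
  by apply: leq_sum => u _; case: (k u) => [|[|m]] //; rewrite -(addn2 m) sqrnD; lia.
suff : \sum_(u in nbr v) k u <= #|nbr v| + #|L| ^ 2 by []; lia.
Qed.

(** * Two-step estimates for a vector y with r y <= A y *)

Local Open Scope ring_scope.

Variables (F : realFieldType) (y : T -> F) (r : F).
Hypothesis y0 : forall v, 0 <= y v.
Hypothesis y1 : forall v, y v <= 1.
Hypothesis r0 : 0 < r.
Hypothesis yr : forall v, r * y v <= \sum_(u in nbr v) y u.

Local Notation n := (#|T|%:R : F).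

Lemma two_step v : r ^+ 2 * y v <= \sum_(u in nbr v) \sum_(w in nbr u) y w.
Proof.
rewrite expr2 -mulrA; apply: le_trans (_ : r * \sum_(u in nbr v) y u <= _).
  by rewrite ler_pM2l.
by rewrite mulr_sumr; apply: ler_sum => u _.
Qed.

(** Entries outside [L] contribute at most [t] per arc, and there are at most [12 n] arcs. *)
Lemma two_step_split (X L : {set T}) (t : F) : 0 <= t ->
  (forall w, w \notin L -> y w <= t) ->
  \sum_(u in X) \sum_(w in nbr u) y w <=
  \sum_(u in X) \sum_(w in nbr u :&: L) y w + t * (12 * n).
Proof.
move=> t0 yt.
have -> : \sum_(u in X) \sum_(w in nbr u) y w =
    \sum_(u in X) \sum_(w in nbr u :&: L) y w + \sum_(u in X) \sum_(w in nbr u :\: L) y w.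
  by rewrite -big_split /=; apply: eq_bigr => u _; rewrite (big_setID L).
rewrite lerD2l; apply: le_trans (_ : \sum_(u in X) t * #|nbr u|%:R <= _).
  apply: ler_sum => u _; apply: le_trans (_ : \sum_(w in nbr u :\: L) t <= _).
    by apply: ler_sum => w; rewrite inE => /andP[wL _]; apply: yt.
  rewrite sumr_const -[t *+ _]mulr_natr ler_wpM2l // ler_nat.
  by apply: subset_leq_card; apply: subsetDl.
rewrite -mulr_sumr ler_wpM2l // -natr_sum -natrM ler_nat.
exact: sum_card_nbr.
Qed.

Lemma sum_nbrI_le (X L : {set T}) (t : F) : (forall w, w \in L -> y w <= t) ->
  \sum_(u in X) \sum_(w in nbr u :&: L) y w <= t * (\sum_(u in X) #|nbr u :&: L|)%:R.
Proof.
move=> yt; rewrite natr_sum mulr_sumr; apply: ler_sum => u _.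
rewrite mulr_natr -sumr_const.
by apply: ler_sum => w; rewrite inE => /andP[_]; apply: yt.
Qed.

Definition level (t : F) : {set T} := [set v | t <= y v].

(** Since [r y_v] is at most the degree of [v], each vertex of the level has degree at least [t r],
    and the degrees add up to at most [12 n]. *)
Lemma card_level t : 0 <= t -> #|level t|%:R * (t * r) <= 12 * n.
Proof.
move=> t0; rewrite mulr_natl -sumr_const.
apply: le_trans (_ : \sum_(v in level t) #|nbr v|%:R <= _); last first.
  by rewrite -natr_sum -natrM ler_nat sum_card_nbr.
apply: ler_sum => v; rewrite inE => tv.
apply: le_trans (_ : r * y v <= _); first by rewrite mulrC ler_pM2l.
apply: le_trans (yr v) _; rewrite -sumr_const; exact: ler_sum.
Qed.

Lemma notin_level t w : w \notin level t -> y w <= t.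
Proof. by rewrite inE -ltNge => /ltW. Qed.

(** A first lower bound on degrees, using sparsity alone: the entries above [t] are at most 1 and
    are counted by the arcs between [nbr v] and [level t]. *)
Lemma level_degree (t : F) v : 0 < t ->
  r ^+ 2 * y v <= 12 * #|nbr v|%:R + 12 * #|level t|%:R + t * (12 * n).
Proof.
move=> t0; apply: le_trans (two_step v) _.
apply: le_trans (two_step_split (nbr v) (ltW t0) (@notin_level t)) _.
rewrite lerD2r; apply: le_trans (sum_nbrI_le _ (fun w _ => y1 w)) _.
by rewrite mul1r -mulrDr -natrD -natrM ler_nat sum_card_nbrI.
Qed.

(** The walks that return to [v], one for each neighbour, are split off with their exact weight. *)
Lemma two_step_level (t : F) v : 0 < t ->
  r ^+ 2 * y v <= #|nbr v|%:R * y v +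
    \sum_(u in nbr v) \sum_(w in nbr u :&: (level t :\ v)) y w + t * (12 * n).
Proof.
move=> t0; apply: le_trans (two_step v) _.
apply: le_trans (@two_step_split (nbr v) (v |: level t :\ v) t (ltW t0) _) _.
  by move=> w; rewrite !inE negb_or => /andP[/negbTE ->] /=; rewrite -ltNge => /ltW.
rewrite lerD2r mulr_natl -sumr_const -big_split /=; apply: ler_sum => u.
rewrite in_nbr => vu.
have -> : nbr u :&: (v |: level t :\ v) = v |: (nbr u :&: (level t :\ v)).
  apply/setP => w; rewrite !inE; case: eqP => [->|//] /=; by rewrite sym vu.
by rewrite big_setU1 // !inE eqxx andbF.
Qed.

(** K_{3,3}-freeness lowers the factor 12 of [level_degree] to 2: one degree for the walks back to
    [v], one from [sum_card_nbrI_nbr]. Against [r^2 >= 2(n - 2)], an entry near 1 then forces almost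
    full degree. *)
Lemma two_step_degree (t : F) v : 0 < t ->
  r ^+ 2 * y v <= 2 * #|nbr v|%:R + #|level t|%:R ^+ 2 + t * (12 * n).
Proof.
move=> t0; apply: le_trans (two_step_level v t0) _; rewrite lerD2r.
have h1 : #|nbr v|%:R * y v <= #|nbr v|%:R :> F.
  by rewrite ler_piMr.
have h2 : \sum_(u in nbr v) \sum_(w in nbr u :&: (level t :\ v)) y w <= #|nbr v|%:R + #|level t|%:R ^+ 2.
  apply: le_trans (sum_nbrI_le _ (fun w _ => y1 w)) _.
  rewrite mul1r -natrX -natrD ler_nat.
  have vL : v \notin level t :\ v by rewrite !inE eqxx.
  apply: leq_trans (sum_card_nbrI_nbr vL) _.
  by rewrite leq_add2l leq_sqr subset_leq_card // subD1set.
lra.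
Qed.

Hypothesis n_large : 216 * 10 ^+ 15 <= n.
Hypothesis r_large : 2 * (n - 2) <= r ^+ 2.
Variable p : T.
Hypothesis yp : y p = 1.
Hypothesis C3C3free : forall a b c d : T,
  uniq [:: a; b; c; d] -> e a b -> e a c -> e a d -> e b c -> e b d -> False.

(* [degree_level] needs 2 eta > 12 eps + 144 / (eps r), which is about 0.0033 for
   the best eps; [small_outside] needs 30 eta < 1 / 16. *)
Local Notation eps := (1 / (7 * 10 ^+ 3) : F).
Local Notation eta := (9 / (5 * 10 ^+ 3) : F).

Lemma r_lower_bound : 65 * 10 ^+ 7 <= r.
Proof.
rewrite leNgt; apply/negP => h.
(* The square is 4.225 * 10^17, below 2(n - 2), which is about 4.32 * 10^17 or more. *)
have : r ^+ 2 < (65 * 10 ^+ 7) ^+ 2 by rewrite ltrXn2r ?ltW.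
have := r_large; have := n_large; lra.
Qed.

(** In [level_degree] at [eps] the error terms are about 0.00155 n and 0.00172 n, against 2 eta n =
    0.0036 n; a twelfth of what remains exceeds 27 n / 10^6. *)
Lemma degree_level v : v \in level eta -> 27 / 10 ^+ 6 * n <= #|nbr v|%:R.
Proof.
rewrite inE => hv.
have e0 : 0 < eps by lra.
have h1 := level_degree v e0.
have h2 := card_level (ltW e0).
have h3 : #|level eps|%:R * (eps * (65 * 10 ^+ 7)) <= 12 * n.
  apply: le_trans h2; rewrite ler_wpM2l // ler_pM2l //; exact: r_lower_bound.
have h4 : 2 * (n - 2) * eta <= r ^+ 2 * y v.
  apply: ler_pM => //; try lra; have := n_large; lra.
have := n_large; lra.
Qed.

(** Linear degrees and a total degree of at most [12 n] bound the level by 12 * 10^6 / 27,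
    independently of [n]. The square, about 1.98 * 10^11, is below n / 10^6. *)
Lemma card_level_eta : #|level eta|%:R ^+ 2 <= n / 10 ^+ 6.
Proof.
have n0 : 0 < n by have := n_large; lra.
have h : #|level eta|%:R <= 12 * 10 ^+ 6 / 27 :> F.
  have : #|level eta|%:R * (27 / 10 ^+ 6 * n) <= 12 * n.
    rewrite mulr_natl -sumr_const.
    apply: le_trans (_ : \sum_(v in level eta) #|nbr v|%:R <= _); last first.
      by rewrite -natr_sum -natrM ler_nat sum_card_nbr.
    by apply: ler_sum => v; exact: degree_level.
  rewrite mulrA ler_pM2r //; lra.
have : #|level eta|%:R ^+ 2 <= (12 * 10 ^+ 6 / 27) ^+ 2 :> F.
  by rewrite lerXn2r // nnegrE ?ler0n //; lra.
have := n_large; lra.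
Qed.

(** Half of [two_step_degree] at [eta]: the error is 6 eta = 0.0108 plus half of 10^-6. *)
Lemma degree_lower_bound v :
  (n - 2) * y v <= #|nbr v|%:R + 109 / 10 ^+ 4 * n.
Proof.
have t0 : 0 < eta by lra.
have h1 := two_step_degree v t0; have h2 := card_level_eta.
have h3 : 2 * (n - 2) * y v <= r ^+ 2 * y v by rewrite ler_wpM2r.
have := n_large; lra.
Qed.

Lemma card_le_n (X : {set T}) : #|X|%:R <= n.
Proof. by rewrite ler_nat max_card. Qed.

(** If all entries of the level other than [y p] were below 0.978, the expansion at [p] would give
    2(n - 2) <= (1 + 0.978 + 0.0216 + 10^-6) n, whose coefficient is below 2. *)
Lemma second_hub : exists2 q, q != p & 978 / 10 ^+ 3 <= y q.
Proof.
have t0 : 0 < eta by lra.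
have h1 := two_step_level p t0; have h2 := card_level_eta.
case: (boolP [exists q, (q != p) && (978 / 10 ^+ 3 <= y q)]) => [/existsP[q /andP[]]|].
  by exists q.
rewrite negb_exists => /forallP small.
have yt w : w \in level eta :\ p -> y w <= 978 / 10 ^+ 3.
  by rewrite !inE => /andP[wp _]; have := small w; rewrite wp /= -ltNge => /ltW.
have h3 := sum_nbrI_le (nbr p) yt.
have h4 : (\sum_(u in nbr p) #|nbr u :&: (level eta :\ p)|)%:R <= #|nbr p|%:R + #|level eta|%:R ^+ 2 :> F.
  rewrite -[#|level eta|%:R ^+ 2]natrX -natrD ler_nat.
  have pL : p \notin level eta :\ p by rewrite !inE eqxx.
  apply: leq_trans (sum_card_nbrI_nbr pL) _.
  by rewrite leq_add2l leq_sqr subset_leq_card // subD1set.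
have h5 := card_le_n (nbr p); rewrite yp !mulr1 in h1.
have := r_large; have := n_large; lra.
Qed.

(** * Vertices missing one of the two hubs *)

Section TwoHubs.

Variable q : T.
Hypothesis qp : q != p.
Hypothesis yq : 978 / 10 ^+ 3 <= y q.

Let H : {set T} := ~: [set p; q].
Let H0 : {set T} := nbr p :&: nbr q.
Let H1 : {set T} := H :\: H0.

Lemma card_H : #|H|%:R = n - 2.
Proof.
have := cardsC [set p; q]; rewrite cards2 (eq_sym p q) qp -/H /= => <-.
by rewrite natrD addrC addKr.
Qed.

Lemma degree_p : 989 / 10 ^+ 3 * n <= #|nbr p|%:R.
Proof. by have := degree_lower_bound p; rewrite yp mulr1; have := n_large; lra. Qed.

Lemma degree_q : 967 / 10 ^+ 3 * n <= #|nbr q|%:R.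
Proof.
have := degree_lower_bound q.
have : (n - 2) * (978 / 10 ^+ 3) <= (n - 2) * y q.
  by rewrite ler_wpM2l //; have := n_large; lra.
have := n_large; lra.
Qed.

Lemma card_hubs : #|nbr p|%:R + #|nbr q|%:R = #|nbr p :|: nbr q|%:R + #|H0|%:R :> F.
Proof. by rewrite -!natrD cardsUI. Qed.

(** The degrees force two common neighbours, so an edge [p q] would be shared by two triangles. *)
Lemma hubs_not_adjacent : ~~ e p q.
Proof.
apply/negP => epq.
have : (1 < #|H0|)%N.
  rewrite -(ltr_nat F); have := card_hubs; have := card_le_n (nbr p :|: nbr q).
  have := degree_p; have := degree_q; have := n_large; lra.
case/card_gt1P=> c [d [cH dH cd]].
move: cH dH; rewrite !inE => /andP[pc qc] /andP[pd qd].
apply: (@C3C3free p q c d) => //=; rewrite !inE !negb_or cd (eq_sym p q) qp andbT /=.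
have ne u v : e u v -> u != v by apply: contraTneq => ->; rewrite irr.
by rewrite !ne.
Qed.

Lemma nbr_hubs_sub : nbr p :|: nbr q \subset H.
Proof.
apply/subsetP => u; rewrite !inE negb_or => /orP[pu|qu].
  apply/andP; split; first by apply: contraTneq pu => ->; rewrite irr.
  by apply: contraTneq pu => ->; exact: hubs_not_adjacent.
apply/andP; split; last by apply: contraTneq qu => ->; rewrite irr.
by apply: contraTneq qu => ->; rewrite sym; exact: hubs_not_adjacent.
Qed.

Lemma H0_sub : H0 \subset H.
Proof. by apply: subset_trans nbr_hubs_sub; apply: subset_trans (subsetIl _ _) (subsetUl _ _). Qed.

Lemma card_H1 : #|H1|%:R = n - 2 - #|H0|%:R.
Proof.
rewrite -card_H -(cardsID H0 H) natrD -/H1.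
by rewrite (setIidPr H0_sub); ring.
Qed.

(** By inclusion-exclusion [#|H1|] is at most 2(n - 2) minus the degrees of [p] and [q]; the
    constant is 0.022 + 2 * 0.0109. *)
Lemma card_H1_le : #|H1|%:R <= 438 / 10 ^+ 4 * n.
Proof.
have := card_H1; have := card_hubs; have := degree_p; have := degree_q.
have : #|nbr p :|: nbr q|%:R <= n - 2 by rewrite -card_H ler_nat subset_leq_card // nbr_hubs_sub.
have := degree_lower_bound p; have := degree_lower_bound q; rewrite yp mulr1.
have : (n - 2) * (978 / 10 ^+ 3) <= (n - 2) * y q.
  by rewrite ler_wpM2l //; have := n_large; lra.
have := n_large; lra.
Qed.

Lemma card_nbr_H0 z : z \in H -> (#|nbr z :&: H0| <= 2)%N.
Proof.
rewrite !inE negb_or => /andP[zp zq].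
rewrite eq_sym in zp; rewrite eq_sym in zq.
have pq : p != q by rewrite eq_sym.
apply: leq_trans (K33free pq zp zq); apply: subset_leq_card.
by apply/subsetP => u; rewrite !inE andbC andbA.
Qed.

(** Such a [z] has at most 2 neighbours among the hubs, 2 in [H0], and [#|H1|] others, so
    [degree_lower_bound] gives roughly 0.0438 + 0.0109 = 0.0547, below 1/17. *)
Lemma small_outside z : z \in H -> y z <= 1 / 17.
Proof.
move=> zH.
have dz : (#|nbr z| <= 4 + #|H1|)%N.
  have -> : nbr z = (nbr z :&: [set p; q]) :|: ((nbr z :&: H0) :|: (nbr z :&: H1)).
    apply/setP => u; rewrite !inE negb_or; case: (e z u) => //=.
    by case: (u == p); case: (u == q) => //=; case: (e p u); case: (e q u).
  apply: leq_trans (leq_card_setU _ _) _.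
  have h1 : (#|nbr z :&: [set p; q]| <= 2)%N.
    apply: leq_trans (subset_leq_card (subsetIr _ _)) _.
    by rewrite cards2; case: (_ == _).
  have [h2 _] := leq_card_setU (nbr z :&: H0) (nbr z :&: H1).
  have h3 := card_nbr_H0 zH.
  have h4 := subset_leq_card (subsetIr (nbr z) H1).
  lia.
have {}dz : #|nbr z|%:R <= 4 + #|H1|%:R :> F by rewrite -natrD ler_nat.
have h := degree_lower_bound z; have b := card_H1_le.
rewrite leNgt; apply/negP => hz.
have : (n - 2) * (1 / 17) <= (n - 2) * y z.
  by rewrite ler_wpM2l ?ltW //; have := n_large; lra.
have := n_large; lra.
Qed.

(** An edge inside [H0] would form C_3.C_3 with [p] and [q]. Each vertex of [H1] sends at most 2
    edges to [H0], giving 4 arcs, and [sparse] adds 12 per vertex inside [H1]. *)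
Lemma arcs_H : (arcs H e <= 16 * #|H1|)%N.
Proof.
have HI : H :&: H0 = H0 by apply/setIidPr; exact: H0_sub.
have cross : (\sum_(u in H1) \sum_(v in H0) e u v <= 2 * #|H1|)%N.
  rewrite mulnC -sum_nat_const; apply: leq_sum => u; rewrite inE => /andP[_ uH].
  by rewrite -card_nbrI card_nbr_H0.
have indep : (\sum_(u in H0) \sum_(v in H0) e u v = 0)%N.
  apply: big1 => u; rewrite !inE => /andP[pu qu]; apply: big1 => v.
  rewrite !inE => /andP[pv qv]; case: (boolP (e u v)) => // uv; exfalso.
  have ne a b : e a b -> a != b by apply: contraTneq => ->; rewrite irr.
  apply: (@C3C3free u v p q) => //; rewrite ?(sym u) ?(sym v) //= !inE !negb_or.
  rewrite (eq_sym p q) qp (ne _ _ uv) (eq_sym u) (eq_sym u) (eq_sym v) (eq_sym v).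
  by rewrite !ne.
rewrite /arcs (big_setID H0) /= HI -/H1.
have -> : (\sum_(u in H0) \sum_(v in H) e u v = \sum_(u in H1) \sum_(v in H0) e u v)%N.
  rewrite [RHS]exchange_big /= -[LHS]addn0.
  transitivity (\sum_(u in H0) (\sum_(v in H0) e u v + \sum_(v in H1) e v u))%N.
    rewrite addn0; apply: eq_bigr => u _; rewrite (big_setID H0) /= HI -/H1.
    by congr addn; apply: eq_bigr => v _; rewrite sym.
  by rewrite big_split /= indep.
have -> : (\sum_(u in H1) \sum_(v in H) e u v =
   \sum_(u in H1) \sum_(v in H0) e u v + arcs H1 e)%N.
  rewrite /arcs -big_split /=; apply: eq_bigr => u _.
  by rewrite (big_setID H0) /= HI.
have := sparse H1; lia.
Qed.

(* The two-step bound at [p] leaves no room for a vertex missing [p] or [q]. *)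
Lemma H1_empty : H1 = set0.
Proof.
have h := two_step p; rewrite yp mulr1 in h.
have split2 : \sum_(u in nbr p) \sum_(w in nbr u) y w <=
   #|nbr p|%:R + #|H0|%:R + 1 / 17 * (arcs H e)%:R.
  have -> : \sum_(u in nbr p) \sum_(w in nbr u) y w =
     \sum_(u in nbr p) \sum_(w in nbr u :&: H) y w + \sum_(u in nbr p) \sum_(w in nbr u :\: H) y w.
    by rewrite -big_split /=; apply: eq_bigr => u _; rewrite (big_setID H).
  rewrite addrC; apply: lerD.
    apply: le_trans (_ : \sum_(u in nbr p) (#|nbr u :\: H|)%:R <= _).
      by apply: ler_sum => u _; rewrite -sumr_const; apply: ler_sum.
    rewrite -natr_sum -natrD ler_nat.
    (* Off [H], a neighbour of [p] sees [p] itself, and [q] exactly when it lies in [H0]. *)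
    apply: leq_trans (_ : (\sum_(u in nbr p) (1 + (u \in nbr q)) <= _)%N); last first.
      rewrite big_split /= sum1_card sum_mem_nat leq_add2l.
      by apply: subset_leq_card; apply/subsetP => u; rewrite !inE.
    apply: leq_sum => u _; rewrite /H setDE setCK card_nbrI.
    rewrite big_setU1 ?inE 1?eq_sym // big_set1 /= (sym u q).
    by rewrite leq_add2r; case: (e u p).
  apply: le_trans (sum_nbrI_le _ small_outside) _.
  rewrite ler_wpM2l //; first lra.
  rewrite ler_nat /arcs (big_setID (nbr p) (A := H)) /=.
  rewrite (setIidPr (subset_trans (subsetUl _ _) nbr_hubs_sub)).
  apply: leq_trans (leq_addr _ _); apply: leq_sum => u _.
  by rewrite card_nbrI.
apply/eqP; rewrite -cards_eq0 -leqn0 -(ler_nat F).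
have aH : (arcs H e)%:R <= 16 * #|H1|%:R :> F by rewrite -natrM ler_nat arcs_H.
have dp : #|nbr p|%:R <= n - 2.
  by rewrite -card_H ler_nat subset_leq_card // (subset_trans (subsetUl _ _) nbr_hubs_sub).
have := card_H1; have := r_large; lra.
Qed.

End TwoHubs.

Lemma complete_bipartite_structure : exists q, [/\ q != p, ~~ e p q &
  forall z, z != p -> z != q -> e p z && e q z].
Proof.
have [q qp yq] := second_hub; exists q; split=> //; first exact: hubs_not_adjacent.
move=> z zp zq; have := H1_empty qp yq => /setP /(_ z).
by rewrite !inE negb_or zp zq andbT; case: (e p z); case: (e q z).
Qed.

End SparseK33Free.

(** * Spectral radii *)

Lemma fat_drawing_common_nbr (T : finType) (e : rel T) (a b c : T) :
  irreflexive e -> fat_drawing [set: T] e -> a != b -> a != c -> b != c ->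
  #|[set u | [&& e a u, e b u & e c u]]| <= 2.
Proof.
move=> irr fat ab ac bc; rewrite leqNgt; apply/negP => h.
have [Y sY cY] := subset_card_exists h.
have YP u : u \in Y -> [&& e a u, e b u & e c u] by move/(subsetP sY); rewrite inE.
apply: (@fat_drawing_no_biclique T [set: T] e [set a; b; c] Y) => //.
- apply/pred0P => u /=; rewrite !inE; apply/negbTE/negP => /andP[+ /YP].
  by case/orP=> [/orP[]|] /eqP ->; rewrite irr ?andbF.
- by rewrite setUC cardsU1 cards2 ab !inE negb_or eq_sym ac eq_sym bc.
- move=> x u; rewrite !inE => xA /YP /and3P[au bu cu].
  by case/orP: xA => [/orP[]|] /eqP ->.
Qed.

Local Open Scope ring_scope.

(* The triangle inequality suffices here; Perron-Frobenius theory is not needed. *)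
Lemma eigenvalue_subinvariant (n : nat) (e : rel 'I_n) (a : algC) :
  symmetric e -> eigenvalue (adjmx e) a ->
  exists (r : algR) (y : 'I_n -> algR) (p : 'I_n),
    [/\ algRval r = `|a|, forall v, 0 <= y v, forall v, y v <= 1, y p = 1
      & forall v, r * y v <= \sum_(u in nbr e v) y u].
Proof.
move=> sym /eigenvalueP [v vA v0].
(* Moduli are taken in [algR], because the estimates above require a [realFieldType] and [algC] is
   not totally ordered. *)
pose z i : algR := in_algR (normr_real (v 0 i)).
pose r : algR := in_algR (normr_real a).
have z0 i : 0 <= z i by rewrite [_ <= _](normr_ge0 (v 0 i)).
have zr j : r * z j <= \sum_(u in nbr e j) z u.
  rewrite [_ <= _](_ : _ = (algRval (r * z j) <= algRval (\sum_(u in nbr e j) z u))) //.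
  rewrite rmorphM rmorph_sum /= -normrM.
  have -> : a * v 0 j = \sum_(u in nbr e j) v 0 u.
    have := congr1 (fun m : 'rV_n => m 0 j) vA; rewrite !mxE => <-.
    rewrite [RHS]big_mkcond /=; apply: eq_bigr => u _; rewrite !mxE in_nbr sym.
    by case: (e j u); rewrite ?mulr1 ?mulr0.
  exact: ler_norm_sum.
have [i0 vi0] : exists i0, v 0 i0 != 0.
  by apply/existsP; apply: contraNT v0; rewrite negb_exists => /forallP h;
    apply/eqP/rowP => i; rewrite mxE; apply/eqP; have := h i; rewrite negbK.
have [p _ pmax] := @arg_maxP _ _ _ i0 predT z isT.
have zp : 0 < z p.
  apply: lt_le_trans (pmax i0 isT); rewrite lt_neqAle z0 andbT eq_sym.
  by apply: contraNneq vi0 => /(congr1 algRval) /= /normr0_eq0 ->.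
exists r, (fun i => z i / z p), p; split=> //.
- by move=> i; apply: divr_ge0 => //; apply: ltW.
- by move=> i; rewrite ler_pdivrMr // mul1r; apply: pmax.
- by rewrite divff // gt_eqF.
- move=> j; rewrite mulrA -mulr_suml ler_pdivrMr // divfK ?gt_eqF //.
Qed.

(** Bounds the spectral radius of K_{2,n-2} from below; this is how [rK <= rG] becomes
    [r^2 >= 2(n - 2)]. *)
Lemma eigenvalue_K2n (n : nat) : (2 < n)%N ->
  eigenvalue (adjmx (@K2n n)) (sqrtC (2 * (n - 2)%:R)).
Proof.
case: n => [|[|m]] // m0; rewrite !subSS subn0.
set s := sqrtC _; have s2 : s * s = 2 * m%:R by rewrite -expr2 sqrtCK.
(* Weight [s] on the two hubs and 2 elsewhere: the hubs receive 2(n - 2) = s * s, the others s + s =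
   s * 2. *)
apply/eigenvalueP; exists (\row_i (if (i < 2)%N then s else 2)).
  apply/rowP => j; rewrite !mxE !big_ord_recl /=.
  under eq_bigr => i _ do rewrite !mxE /=.
  rewrite !mxE /K2n /=; case: (ltnP j 2) => hj /=.
    rewrite !mulr0 !add0r s2.
    by under eq_bigr => i _ do rewrite mulr1; rewrite sumr_const card_ord mulr_natr.
  under eq_bigr => i _ do rewrite mulr0.
  by rewrite big1 // addr0 !mulr1; ring.
apply/eqP => /rowP /(_ (Ordinal m0)); rewrite !mxE /=; apply/eqP.
by rewrite pnatr_eq0.
Qed.

Lemma eigenvalue_graph_iso (n : nat) (e f : rel 'I_n) (a : algC) :
  graph_iso e f -> eigenvalue (adjmx f) a -> eigenvalue (adjmx e) a.
Proof.
case=> s ef /eigenvalueP [v vA v0]; apply/eigenvalueP.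
exists (\row_i v 0 (s i)).
  apply/rowP => j; have := congr1 (fun m : 'rV_n => m 0 (s j)) vA; rewrite !mxE => <-.
  rewrite [RHS](reindex_inj (@perm_inj _ s)) /=.
  by apply: eq_bigr => i _; rewrite !mxE ef.
apply: contraNneq v0 => /rowP h; apply/eqP/rowP => i.
by have := h (s^-1 i)%g; rewrite !mxE permKV.
Qed.

Lemma graph_iso_sym (n : nat) (e f : rel 'I_n) : graph_iso e f -> graph_iso f e.
Proof. by case=> s ef; exists s^-1%g => i j; rewrite -ef !permKV. Qed.

Lemma spectral_radius_graph_iso (n : nat) (e f : rel 'I_n) (r s : algC) :
  spectral_radius_is (adjmx e) r -> spectral_radius_is (adjmx f) s ->
  graph_iso e f -> r = s.
Proof.
move=> [[a ea <-] ler] [[b fb <-] les] iso; apply/le_anti/andP; split.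
  by apply: les; apply: eigenvalue_graph_iso (graph_iso_sym iso) ea.
by apply: ler; apply: eigenvalue_graph_iso iso fb.
Qed.

Lemma graph_iso_K2n (n : nat) (e : rel 'I_n) (p q : 'I_n) : (1 < n)%N -> q != p ->
  (forall i j, e i j = ((i == p) || (i == q)) (+) ((j == p) || (j == q))) ->
  graph_iso e (@K2n n).
Proof.
move=> n1 qp eE.
pose o0 := Ordinal (ltnW n1); pose o1 := Ordinal n1.
have o01 : o1 != o0 by [].
(* After [p] is sent to 0, the vertex [q] sits at [q']; the second transposition sends it to 1 and
   fixes 0. *)
pose q' := tperm p o0 q.
have q'0 : q' != o0 by rewrite -[X in _ != X](tpermL p o0) (inj_eq perm_inj).
pose s := (tperm p o0 * tperm q' o1)%g.
have sp : s p = o0 by rewrite permM tpermL tpermD // eq_sym.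
have sq : s q = o1 by rewrite permM tpermL.
exists s => i j; rewrite eE /K2n.
have lt2 k : (s k < 2)%N = (k == p) || (k == q).
  rewrite -(inj_eq (@perm_inj _ s) k p) -(inj_eq (@perm_inj _ s) k q) sp sq.
  by rewrite -!val_eqE /=; case: (nat_of_ord (s k)) => [|[|]].
by rewrite !lt2; case: (_ || _); case: (_ || _).
Qed.

Theorem theorem3 (n : nat) (e : rel 'I_n) :
  (216 * 10 ^ 15 <= n)%N ->
  simple_graph e -> planar e -> ~ has_C3C3 e ->
  forall rG rK : algC,
    spectral_radius_is (adjmx e) rG ->
    spectral_radius_is (adjmx (@K2n n)) rK ->
    rG <= rK /\ (rG = rK <-> graph_iso e (@K2n n)).
Proof.
move=> n_large simple pl noC3C3 rG rK hG hK.
have [irr' sym] := simple; have irr : irreflexive e by move=> i; apply/negbTE.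
have fat := planar_fat_drawing simple pl.
have {n_large} n_largeR : 216 * 10 ^+ 15 <= n%:R :> algR.
  by rewrite -natrX -natrM ler_nat.
have n2 : (2 < n)%N by rewrite -(ltr_nat algR); lra.
(* Isomorphic graphs have equal radii and the radii are real, hence comparable, so this one
   implication gives both the inequality and the equality case. *)
suff key : rK <= rG -> graph_iso e (@K2n n).
  have rGR : rG \is Num.real by case: hG => [[a _ <-] _]; exact: normr_real.
  have rKR : rK \is Num.real by case: hK => [[a _ <-] _]; exact: normr_real.
  split; last split.
  - case/orP: (real_leVge rGR rKR) => // /key iso.
    by rewrite (spectral_radius_graph_iso hG hK iso).
  - by move=> eq; apply: key; rewrite eq.
  - exact: spectral_radius_graph_iso hG hK.
move=> KG; have [[a ea aG] _] := hG.
have [r [y [p [ra y0 y1 yp yr]]]] := eigenvalue_subinvariant sym ea.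
have rsK : sqrtC (2 * (n - 2)%:R) <= `|a|.
  rewrite aG; apply: le_trans KG; have := hK.2 _ (eigenvalue_K2n n2).
  by rewrite ger0_norm // sqrtC_ge0 mulr_ge0.
have r2 : 2 * ((n - 2)%:R : algR) <= r ^+ 2.
  rewrite [_ <= _](_ : _ = (algRval (2 * (n - 2)%:R) <= algRval (r ^+ 2))) //.
  have -> : algRval (r ^+ 2) = `|a| ^+ 2 by rewrite rmorphXn /= ra.
  have -> : algRval (2 * (n - 2)%:R) = 2 * (n - 2)%:R by rewrite rmorphM !rmorph_nat.
  rewrite -[leLHS]sqrtCK.
  by rewrite ler_sqr ?nnegrE ?sqrtC_ge0 ?mulr_ge0 //.
have cT : #|'I_n| = n by rewrite card_ord.
have r0 : 0 < r.
  rewrite lt_neqAle; apply/andP; split; last first.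
    by rewrite [_ <= _](_ : _ = (0 <= algRval r)) // ra.
  apply: contraTneq r2 => <-; rewrite expr0n /= -ltNge.
  by rewrite mulr_gt0 // ltr0n subn_gt0.
have C3C3free (b c d f : 'I_n) : uniq [:: b; c; d; f] ->
    e b c -> e b d -> e b f -> e c d -> e c f -> False.
  by move=> u *; apply: noC3C3; exists b, c, d, f; split.
have sparse (V : {set 'I_n}) : (arcs V e <= 12 * #|V|)%N.
  apply: fat_drawing_sparse => //; apply: fat_drawing_sub fat => //; exact: subsetT.
have [||q [qp pq hub]] := @complete_bipartite_structure _ _ sym irr sparse
  (fun u v w => @fat_drawing_common_nbr _ _ u v w irr fat) _ _ _ y0 y1 r0 yr _ _ _ yp C3C3free.
- by rewrite cT.
- by rewrite cT -natrB // ltnW.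
apply: (@graph_iso_K2n _ _ p q) => //; first exact: ltnW.
move=> i j.
case: (eqVneq i p) => [->|ip] /=.
  case: (eqVneq j p) => [->|jp] /=; first by rewrite irr.
  case: (eqVneq j q) => [->|jq] /=; first exact: negbTE.
  by have /andP[] := hub j jp jq.
case: (eqVneq i q) => [->|iq] /=.
  case: (eqVneq j p) => [->|jp] /=; first by rewrite sym; exact: negbTE.
  case: (eqVneq j q) => [->|jq] /=; first by rewrite irr.
  by have /andP[] := hub j jp jq.
have /andP[pi qi] := hub i ip iq.
case: (eqVneq j p) => [->|jp] /=; first by rewrite sym.
case: (eqVneq j q) => [->|jq] /=; first by rewrite sym.
have /andP[pj qj] := hub j jp jq.
(* An edge between two vertices off the hubs would lie in triangles with both [p] and [q]. *)
apply/negbTE/negP => ij; apply: (C3C3free i j p q) => //; rewrite 1?sym //.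
rewrite /= !inE !negb_or ip iq jp jq (eq_sym p q) qp !andbT.
by apply: contraTneq ij => ->; rewrite irr.
Qed.
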